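(* Let $K$ be a field with a valuation $\mathrm{val}\colon K^*\to\mathbb R$ with value group $\Gamma$, admitting a group homomorphism $\Gamma\to K^*$, $\gamma\mapsto t^\gamma$, with $\mathrm{val}(t^\gamma)=\gamma$, and let $S=K[x_1,\dots,x_n]$. Let $f_1,\dots,f_l\in S$ be nonzero homogeneous polynomials, $I=\langle f_1,\dots,f_l\rangle$, $w\in\mathbb R^n$, and $\prec$ a monomial term order. Then the Buchberger algorithm described in the context, applied to $f_1,\dots,f_l$, $w$, $\prec$, terminates after finitely many steps, and its output is a list $\{g_1,\dots,g_s\}$ of homogeneous polynomials in $I$ such that $\{\mathrm{in}_\prec(\mathrm{in}_w(g_i)):1\le i\le s\}$ generates the ideal $\mathrm{in}_\prec(\mathrm{in}_w(I))$.
   Context: Notation. $R=\{a\in K:\mathrm{val}(a)\ge 0\}\cup\{0\}$ is the valuation ring, $\mathfrak m$ its maximal ideal, $\Bbbk=R/\mathfrak m$ the residue field, and $\overline a$ denotes the image of $a\in R$ in $\Bbbk$; $\mathrm{val}(0)=\infty$. For nonzero $f=\sum c_ux^u\in S$ and $w\in\mathbb R^n$, let $W=\min\{\mathrm{val}(c_u)+w\cdot u: c_u\ne 0\}$ and $$\mathrm{in}_w(f)=\sum_{\mathrm{val}(c_u)+w\cdot u=W}\overline{t^{-\mathrm{val}(c_u)}c_u}\,x^u\in\Bbbk[x_1,\dots,x_n].$$ For a homogeneous ideal $I\subseteq S$, $\mathrm{in}_w(I)=\langle \mathrm{in}_w(f): f\in I\setminus\{0\}\rangle\subseteq\Bbbk[x_1,\dots,x_n]$.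 A term order $\prec$ is a monomial order in the usual Gröbner sense; $\mathrm{in}_\prec$ denotes the leading term ($\prec$-largest) of a polynomial in $\Bbbk[x_1,\dots,x_n]$, resp. the usual initial ideal. $\mathrm{lm}(f)$ is the monomial $x^u$ occurring in $\mathrm{in}_\prec(\mathrm{in}_w(f))$, and $\mathrm{lc}(f)\in K$ is the coefficient of this $x^u$ in $f$. Order on polynomials. For nonzero homogeneous $f,g$ with $\mathrm{lm}(f)=x^u$, $\mathrm{lm}(g)=x^v$, $\mathrm{lc}(f)=a$, $\mathrm{lc}(g)=b$: $f<g$ if $\mathrm{val}(a)+w\cdot u<\mathrm{val}(b)+w\cdot v$, or if $\mathrm{val}(a)+w\cdot u=\mathrm{val}(b)+w\cdot v$ and $x^u\succ x^v$. Also $f<0$ for all nonzero $f$. We write $g\ge f$ when $g<f$ does not hold. Normal form. A normal form (remainder) on dividing a homogeneous $f$ by nonzero homogeneous polynomials $g_1,\dots,g_s$ is a homogeneous $r\in S$ for which there are homogeneous $h_1,\dots,h_s\in S$ with $f=\sum h_ig_i+r$, $h_ig_i\ge f$ for all $i$, $r\ge f$, and no monomial occurring in $r$ with nonzero coefficient divisible by any $\mathrm{lm}(g_i)$. Such a normal form always exists (it is computed by a division algorithm). $S$-polynomial: $$S(f,g)=\mathrm{lc}(g)\frac{\mathrm{lcm}(\mathrm{lm}(f),\mathrm{lm}(g))}{\mathrm{lm}(f)}f-\mathrm{lc}(f)\frac{\mathrm{lcm}(\mathrm{lm}(f),\mathrm{lm}(g))}{\mathrm{lm}(g)}g.$$ Buchberger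 algorithm. (1) Set $\mathcal G=\{f_1,\dots,f_l\}$ and $\mathcal P=\{(g,g'):g,g'\in\mathcal G\}$. (2) While $\mathcal P\ne\emptyset$: (a) pick $(g,g')\in\mathcal P$ and remove it from $\mathcal P$; (b) let $r$ be a normal form on dividing $S(g,g')$ by $\mathcal G$; if $r\ne 0$, set $\mathcal G=\mathcal G\cup\{r\}$ and $\mathcal P=\mathcal P\cup\{(r,g):g\in\mathcal G\}$. (3) Return $\mathcal G$. *)

(* Defs.v *)
From HB Require Import structures.
From Stdlib Require Import Relation_Operators.
From mathcomp Require Import all_boot all_order all_algebra generic_quotient ring_quotient.
From mathcomp Require Import reals finmap.
From mathcomp.multinomials Require Import mpoly.

Set Implicit Arguments.
Unset Strict Implicit.
Unset Printing Implicit Defensive.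

Import Order.TTheory GRing.Theory Num.Theory.

Local Open Scope fset_scope.
Local Open Scope ring_scope.
Local Open Scope quotient_scope.

(* A valuation K^* -> R is encoded as a total function on K whose value at 0
   is unspecified; no definition below depends on that value. *)
Record valuation (R : realType) (K : fieldType) := Valuation {
  valuation_fun :> K -> R;
  valuationM : forall a b, a != 0 -> b != 0 ->
    valuation_fun (a * b) = valuation_fun a + valuation_fun b;
  valuationD : forall a b, a != 0 -> b != 0 -> a + b != 0 ->
    Num.min (valuation_fun a) (valuation_fun b) <= valuation_fun (a + b)
}.

Definition value_group (R : realType) (K : fieldType) (v : valuation R K)
  (gamma : R) : Prop := exists2 a : K, a != 0 & v a = gamma.

(* A homomorphism from the value group to K^* that is a section of v; its
   values outside the value group are unspecified and never used. *)
Record splitting (R : realType) (K : fieldType) (v : valuation R K) := Splitting {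
  splitting_fun :> R -> K;
  splitting_neq0 : forall gamma, value_group v gamma -> splitting_fun gamma != 0;
  splittingD : forall gamma delta, value_group v gamma -> value_group v delta ->
    splitting_fun (gamma + delta) = splitting_fun gamma * splitting_fun delta;
  splittingK : forall gamma, value_group v gamma -> v (splitting_fun gamma) = gamma
}.

Section ResidueField.
Context (R : realType) (K : fieldType) (v : valuation R K).

Definition valuation_ring : pred K := fun a => (a == 0) || (0 <= v a).

Lemma valuation1 : v 1 = 0.
Proof.
have := valuationM v (oner_neq0 K) (oner_neq0 K).
by rewrite mulr1 => /eqP; rewrite -subr_eq subrr eq_sym => /eqP.
Qed.

Lemma valuationN a : a != 0 -> v (- a) = v a.
Proof.
move=> a0; have n10 : (-1 : K) != 0 by rewrite oppr_eq0 oner_neq0.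
have vN1 : v (-1) = 0.
  have := valuationM v n10 n10; rewrite mulrNN mulr1 valuation1 => /esym/eqP.
  by rewrite -mulr2n mulrn_eq0 /= => /eqP.
by rewrite -mulN1r valuationM // vN1 add0r.
Qed.

Lemma valuationV a : a != 0 -> v a^-1 = - v a.
Proof.
move=> a0; apply/eqP; rewrite -addr_eq0 addrC -valuationM ?invr_eq0 //.
by rewrite divff // valuation1.
Qed.

Lemma valuation_ring_subring : subring_closed valuation_ring.
Proof.
split.
- by rewrite unfold_in /= valuation1 lexx orbT.
- move=> a b; rewrite !unfold_in /=.
  case: (eqVneq a 0) => [->|a0] /=.
    move=> _; rewrite sub0r oppr_eq0; case: (eqVneq b 0) => //= b0.
    by rewrite valuationN.
  case: (eqVneq b 0) => [->|b0] /=; first by rewrite subr0 => ->; rewrite orbT.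
  move=> va vb; case: (eqVneq (a - b) 0) => //= ab0.
  apply: le_trans (valuationD v _ _ ab0); rewrite ?oppr_eq0 //.
  by rewrite valuationN // le_min va vb.
- move=> a b; rewrite !unfold_in /= mulf_eq0.
  case: (eqVneq a 0) => //= a0; case: (eqVneq b 0) => //= b0 va vb.
  by rewrite valuationM // addr_ge0.
Qed.

HB.instance Definition _ :=
  GRing.isSubringClosed.Build K valuation_ring valuation_ring_subring.

Record valring := ValRing { valring_val : K; _ : valring_val \in valuation_ring }.

HB.instance Definition _ := [isSub for valring_val].
HB.instance Definition _ := [Choice of valring by <:].
HB.instance Definition _ := [SubChoice_isSubComNzRing of valring by <:].

Definition maximal_ideal : pred valring :=
  fun a => (val a == 0) || (0 < v (val a)).

Lemma maximal_ideal_idealr : idealr_closed maximal_ideal.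
Proof.
split.
- by rewrite unfold_in /= eqxx.
- by rewrite unfold_in /= oner_eq0 valuation1 ltxx.
- move=> c a b; rewrite !unfold_in /=; case: c a b => c hc [a ha] [b hb] /=.
  have {hc}: (c == 0) || (0 <= v c) by [].
  case: (eqVneq c 0) => [->|c0] /=; first by rewrite mul0r add0r.
  case: (eqVneq a 0) => [->|a0] /=; first by rewrite mulr0 add0r.
  move=> vc va; have vca : 0 < v (c * a) by rewrite valuationM // ltr_wpDl.
  have ca0 : c * a != 0 by rewrite mulf_neq0.
  case: (eqVneq b 0) => [->|b0] /=; first by rewrite addr0 vca orbT.
  move=> vb; case: (eqVneq (c * a + b) 0) => //= cab0.
  by apply: lt_le_trans (valuationD v _ _ cab0); rewrite // lt_min vca vb.
Qed.

HB.instance Definition _ :=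
  isIdealr.Build valring maximal_ideal maximal_ideal_idealr.

Definition residue_field := {ideal_quot (maximal_ideal : idealr valring)}.

HB.instance Definition _ := GRing.ComNzRing.on residue_field.

(* The image in the residue field of an element of the valuation ring; the
   value 0 on the rest of K is a dummy. *)
Definition residue (a : K) : residue_field := \pi_residue_field (insubd (0 : valring) a).

Definition residue_inv (x : residue_field) : residue_field :=
  if x == 0 then 0 else residue (val (repr x))^-1.

Lemma residue_mulVf : forall x, x != 0 -> residue_inv x * x = 1.
Proof.
move=> x x0; rewrite /residue_inv (negPf x0) /residue.
set a := repr x.
have xE : x = \pi_residue_field a by rewrite reprK.
have : a \notin maximal_ideal.
  apply: contra x0 => am.
  have -> : (0 : residue_field) = \pi_residue_field 0 by rewrite rmorph0.
  by rewrite xE -Quotient.idealrBE subr0.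
rewrite unfold_in /= negb_or -leNgt => /andP[a0 va].
have vV : (val a)^-1 \in valuation_ring.
  by rewrite unfold_in /= invr_eq0 (negPf a0) /= valuationV // oppr_ge0.
rewrite [in X in _ * X = _]xE -rmorphM.
have -> : insubd (0 : valring) (val a)^-1 * a = 1.
  by apply: val_inj; rewrite /= [X in X * _]insubdK //= mulVf.
by rewrite rmorph1.
Qed.

Lemma residue_inv0 : residue_inv 0 = 0.
Proof. by rewrite /residue_inv eqxx. Qed.

HB.instance Definition _ :=
  GRing.ComNzRing_isField.Build residue_field residue_mulVf residue_inv0.

End ResidueField.

Record term_order (n : nat) := TermOrder {
  tle :> rel 'X_{1..n};
  tle_anti : antisymmetric tle;
  tle_trans : transitive tle;
  tle_total : total tle;
  tle0m : forall m, tle 0%MM m;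
  tleD2r : forall m1 m2 m, tle m1 m2 -> tle (m1 + m)%MM (m2 + m)%MM
}.

Definition tlt n (ord : term_order n) : rel 'X_{1..n} :=
  fun m1 m2 => (m1 != m2) && ord m1 m2.

(* As 0 is the least exponent, this is the largest exponent in the support of
   p when p != 0. *)
Definition lexp n (k : fieldType) (ord : term_order n) (p : {mpoly k[n]}) :
    'X_{1..n} :=
  \big[(fun m1 m2 => if ord m1 m2 then m2 else m1) / 0%MM]_(m <- msupp p) m.

Definition lterm n (k : fieldType) (ord : term_order n) (p : {mpoly k[n]}) :
    {mpoly k[n]} :=
  p@_(lexp ord p) *: 'X_[lexp ord p].

Definition homogeneous n (k : fieldType) (p : {mpoly k[n]}) : Prop :=
  exists d, p \is d.-homog.

Definition ideal_gen (A : comNzRingType) (X : A -> Prop) (p : A) : Prop :=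
  exists s : seq (A * A),
    (forall q, q \in s -> X q.2) /\ p = \sum_(q <- s) q.1 * q.2.

Definition lterm_ideal n (k : fieldType) (ord : term_order n)
    (J : {mpoly k[n]} -> Prop) : {mpoly k[n]} -> Prop :=
  ideal_gen (fun q => exists p, [/\ J p, p != 0 & q = lterm ord p]).

Section Buchberger.
Context (R : realType) (K : fieldType) (v : valuation R K) (t : splitting v).
Context (n : nat) (w : 'rV[R]_n) (ord : term_order n).

Local Notation S := {mpoly K[n]}.
Local Notation Sk := {mpoly (residue_field v)[n]}.

Implicit Types (f g h r : S) (u : 'X_{1..n}).

Definition term_weight (c : K) u : R := v c + \sum_(i < n) w 0 i * (u i)%:R.

(* The default value of the iterated minimum belongs to the support when
   f != 0, so it does not affect the result. *)
Definition trop_weight f : R :=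
  \big[Num.min / term_weight (mleadc f) (mlead f)]_(u <- msupp f)
     term_weight f@_u u.

Definition in_w f : Sk :=
  \sum_(u <- msupp f | term_weight f@_u u == trop_weight f)
     residue v (t (- v f@_u) * f@_u) *: 'X_[u].

Definition in_w_ideal (I : S -> Prop) : Sk -> Prop :=
  ideal_gen (fun q => exists f, [/\ I f, f != 0 & q = in_w f]).

Definition lm f : 'X_{1..n} := lexp ord (in_w f).

Definition lc f : K := f@_(lm f).

Definition lweight f : R := term_weight (lc f) (lm f).

Definition plt f g : bool :=
  (f != 0) && [|| g == 0, lweight f < lweight g
                | (lweight f == lweight g) && tlt ord (lm g) (lm f)].

Definition pge g f : bool := ~~ plt g f.

Definition normal_form (gs : seq S) f r : Prop :=
  homogeneous r /\
  exists h : 'I_(size gs) -> S,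
    [/\ forall i, homogeneous (h i),
        f = \sum_(i < size gs) h i * gs`_i + r,
        forall i, pge (h i * gs`_i) f,
        pge r f
      & forall u, u \in msupp r -> forall i : 'I_(size gs), ~~ (lm gs`_i <= u)%MM].

Definition spoly f g : S :=
  let m := mlcm (lm f) (lm g) in
  lc g *: ('X_[m - lm f] * f) - lc f *: ('X_[m - lm g] * g).

(* The current set G and the set P of pairs still to be treated. *)
Definition bstate : Type := ({fset S} * {fset S * S})%type.

Definition binit (fs : seq S) : bstate :=
  let G := [fset g in fs] in (G, G `*` G).

Definition bnext (st : bstate) (p : S * S) r : bstate :=
  let: (G, P) := st in
  if r == 0 then (G, P `\ p)
  else (r |` G, (P `\ p) `|` [fset (r, g) | g in r |` G]).

(* One pass through the loop, for an arbitrary choice of the pair and of the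
   normal form. *)
Definition bstep (st st' : bstate) : Prop :=
  exists p r, [/\ p \in st.2, normal_form st.1 (spoly p.1 p.2) r
                & st' = bnext st p r].

Definition breachable (fs : seq S) : bstate -> Prop :=
  clos_refl_trans bstate bstep (binit fs).

End Buchberger.

(* Main.v *)
From HB Require Import structures.
Require Import Defs.
From mathcomp Require Import all_boot all_order all_algebra.
From mathcomp Require Import ring.
From mathcomp Require Import generic_quotient ring_quotient boolp reals finmap.
From mathcomp.multinomials Require Import mpoly.

Set Implicit Arguments.
Unset Strict Implicit.
Unset Printing Implicit Defensive.

Import Order.TTheory GRing.Theory Num.Theory.

Local Open Scope fset_scope.
Local Open Scope ring_scope.
Local Open Scope quotient_scope.

(* A term [c x^u] has the key [(v c + w.u, u)]; polynomials are compared by the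
   keys of their leading terms, which are minimal in their supports.

   Normal forms.  If [p_1, .., p_N] have pairwise distinct leading exponents
   [u_1, .., u_N], the least of the summands of [sum_i y_i p_i] is not cancelled
   at its leading exponent, so the matrix of the coefficients of the [p_i] at
   the [u_j] is invertible.  Hence every [f] is uniquely [sum_i c_i p_i + r] with
   [r] vanishing at all the [u_j], every [c_i p_i] is at least [f], and [r]
   depends linearly on [f].  Taking one monomial multiple [p_i] of an element of
   the basis for every exponent of degree [d] divisible by a leading exponent
   gives the normal forms in degree [d], without any division algorithm (which
   need not terminate, as the weights are not well-ordered).

   Criterion.  Let [phi] be a coefficient of degree [d] of [r]; it vanishes on
   the [p_i].  Among the monomial multiples [s] of basis elements scaled to
   [phi s = 1], finitely many up to what [phi] kills, take one of largest key.
   Subtracting a multiple of the [p_i] with the same leading exponent gives a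
   monomial times an S-polynomial, hence a sum of multiples of basis elements
   with larger keys; on one of these summands [phi] has valuation at most 0,
   and rescaling it contradicts maximality.  So [phi] vanishes on the ideal.
   A leading exponent of the ideal other than the [u_j] would then be cancelled
   by some [c_i p_i], whose terms at that exponent are too large.

   Initial ideals.  Up to exponents outside one class of weights modulo the
   value group, a sum of multiples of initial forms lifts to an element of the
   ideal whose terms all have weight at least [W], for any [W] in that class, so
   every leading exponent of the initial ideal is the leading exponent of an
   initial form.

   Termination is Dickson's lemma. *)

(** * Valuations, residues and leading exponents *)

Lemma seq_min (T : eqType) (e : rel T) (s : seq T) :
  total e -> transitive e -> s != [::] ->
  exists2 x, x \in s & {in s, forall y, e x y}.
Proof.
move=> e_total e_trans; elim: s => // a s IHs _.
have e_refl z : e z z by have /orP[] := e_total z z.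
case: (eqVneq s [::]) => [->|/IHs [x xs xP]].
  by exists a; rewrite ?mem_head // => y; rewrite inE => /eqP ->.
have /orP[ax|xa] := e_total a x.
  exists a; rewrite ?mem_head // => y; rewrite inE => /predU1P[->//|ys].
  exact: e_trans ax (xP y ys).
exists x; first by rewrite inE xs orbT.
by move=> y; rewrite inE => /predU1P[->//|/xP].
Qed.

Section Monomials.
Context (n : nat) (A : comNzRingType).
Implicit Types (p : {mpoly A[n]}) (b u : 'X_{1..n}).

Lemma mcoeffXM p b u : ('X_[b] * p)@_u = if (b <= u)%MM then p@_(u - b) else 0.
Proof.
case: ifP => [bu|nbu]; first by rewrite -{1}(submK bu) addmC mulrC mcoeffMX.
apply: memN_msupp_eq0; apply: contraFN nbu.
by rewrite mulrC (perm_mem (msuppMX p b)) => /mapP[m' _ ->]; apply: lem_addr.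
Qed.

Lemma mcoeffXMD p b u : ('X_[b] * p)@_(b + u) = p@_u.
Proof. by rewrite mulrC mcoeffMX. Qed.

End Monomials.

Section Valuation.
Context (R : realType) (K : fieldType) (v : valuation R K).

(** The ultrametric inequality used as a selection principle: it names a nonzero summand that
    accounts for the valuation of a nonzero sum. *)
Lemma valuation_sum (T : eqType) (s : seq T) (F : T -> K) :
  \sum_(i <- s) F i != 0 ->
  exists i, [/\ i \in s, F i != 0 & v (F i) <= v (\sum_(i <- s) F i)].
Proof.
elim: s => [|a s IHs]; first by rewrite big_nil eqxx.
rewrite big_cons; have [-> | Fs0] := eqVneq (\sum_(i <- s) F i) 0.
  by rewrite addr0 => Fa0; exists a; rewrite mem_head Fa0 lexx.
have [i [si Fi vi]] := IHs Fs0.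
have [-> _ | Fa0 sum0] := eqVneq (F a) 0.
  by exists i; rewrite add0r inE si orbT Fi vi.
have := valuationD v Fa0 Fs0 sum0; rewrite ge_min => /orP[va|vs].
  by exists a; rewrite mem_head Fa0 va.
by exists i; rewrite inE si orbT Fi (le_trans vi vs).
Qed.

Lemma value_group0 : value_group v 0.
Proof. by exists 1; rewrite ?oner_neq0 ?valuation1. Qed.

Lemma value_groupN x : value_group v x -> value_group v (- x).
Proof. by case=> a a0 <-; exists a^-1; rewrite ?invr_eq0 ?valuationV. Qed.

Lemma value_groupD x y :
  value_group v x -> value_group v y -> value_group v (x + y).
Proof.
by case=> a a0 <- [b b0 <-]; exists (a * b); rewrite ?mulf_neq0 ?valuationM.
Qed.

Lemma value_groupE a : a != 0 -> value_group v (v a).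
Proof. by move=> a0; exists a. Qed.

Lemma valuation_ringE a : (a \in valuation_ring v) = (a == 0) || (0 <= v a).
Proof. by []. Qed.

Lemma residue_val (a : valring v) : residue v (val a) = \pi_(residue_field v) a.
Proof. by rewrite /residue valKd. Qed.

Lemma residueD a b : a \in valuation_ring v -> b \in valuation_ring v ->
  residue v (a + b) = residue v a + residue v b.
Proof.
by move=> va vb; rewrite -[a]/(val (ValRing va)) -[b]/(val (ValRing vb))
  -rmorphD !residue_val rmorphD.
Qed.

Lemma residueM a b : a \in valuation_ring v -> b \in valuation_ring v ->
  residue v (a * b) = residue v a * residue v b.
Proof.
by move=> va vb; rewrite -[a]/(val (ValRing va)) -[b]/(val (ValRing vb))
  -rmorphM !residue_val rmorphM.
Qed.

Lemma residue0 : residue v 0 = 0.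
Proof. by rewrite -[0 in LHS]/(val (0 : valring v)) residue_val rmorph0. Qed.

Lemma residue_eq0 a : a \in valuation_ring v ->
  (residue v a == 0) = (a == 0) || (0 < v a).
Proof.
move=> va; rewrite -[a]/(val (ValRing va)) residue_val -(rmorph0 (\pi_(residue_field v))).
by rewrite -Quotient.idealrBE subr0.
Qed.

Lemma residue_surj x : exists2 a, a \in valuation_ring v & residue v a = x.
Proof.
exists (val (repr x)); first exact: valP.
by rewrite residue_val reprK.
Qed.

Lemma residue_unit a : a != 0 -> v a = 0 -> residue v a != 0.
Proof.
move=> a0 va; rewrite residue_eq0 ?(negPf a0) ?va ?ltxx //.
by rewrite valuation_ringE va lexx orbT.
Qed.

End Valuation.

Section LeadingExponent.
Context (n : nat) (k : fieldType) (ord : term_order n).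
Implicit Types (p : {mpoly k[n]}) (u : 'X_{1..n}).

Lemma tle_refl u : ord u u.
Proof. by have /orP[] := tle_total ord u u. Qed.

Let omax u1 u2 := if ord u1 u2 then u2 else u1.

Let bigomax_spec (s : seq 'X_{1..n}) : s != [::] ->
  let m := \big[omax / 0%MM]_(u <- s) u in m \in s /\ {in s, forall u, ord u m}.
Proof.
elim: s => // a s IHs _; rewrite big_cons /=.
case: (eqVneq s [::]) => [->|/IHs /=].
  rewrite big_nil /omax inE; case: ifP => [a0|_].
    (* The default [0] wins against [a] only if [a] is itself the least exponent, so the result
       stays in the list. *)
    have -> : a = 0%MM by apply: (@tle_anti _ ord); rewrite a0 tle0m.
    by split=> // u; rewrite inE => /eqP ->; apply: tle_refl.
  by split=> // u; rewrite inE => /eqP ->; apply: tle_refl.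
set m := \big[_ / _]_(_ <- _) _ => -[ms mP]; rewrite /omax; case: ifP => am.
  by split=> [|u]; rewrite inE ?ms ?orbT // => /predU1P[->|/mP].
split=> [|u]; first exact: mem_head.
rewrite inE => /predU1P[->|/mP um]; first exact: tle_refl.
by apply: tle_trans um _; have := tle_total ord a m; rewrite am.
Qed.

Lemma lexp_supp p : p != 0 -> lexp ord p \in msupp p.
Proof. by rewrite -msupp_eq0 => /bigomax_spec []. Qed.

Lemma lexp_max p u : u \in msupp p -> ord u (lexp ord p).
Proof.
move=> up; have: msupp p != [::] by apply: contraTneq up => ->.
by case/bigomax_spec => _; apply.
Qed.

Lemma lterm_neq0 p : p != 0 -> p@_(lexp ord p) != 0.
Proof. by move=> p0; rewrite -mcoeff_msupp lexp_supp. Qed.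

End LeadingExponent.

(** * The order on terms and polynomials *)

Section Keys.
Context (R : realType) (K : fieldType) (v : valuation R K) (t : splitting v).
Context (n : nat) (w : 'rV[R]_n) (ord : term_order n).

Local Notation S := {mpoly K[n]}.
Local Notation term_weight := (term_weight v w).
Local Notation trop_weight := (trop_weight v w).
Local Notation in_w := (in_w t w).
Local Notation lm := (lm t w ord).
Local Notation lc := (lc t w ord).
Local Notation lweight := (lweight t w ord).

Implicit Types (f g h r : S) (u : 'X_{1..n}).

Definition mweight u : R := \sum_(i < n) w 0 i * (u i)%:R.

Lemma mweightD u b : mweight (u + b)%MM = mweight u + mweight b.
Proof.
by rewrite -big_split; apply: eq_bigr => i _; rewrite mnmDE natrD mulrDr.
Qed.

Definition key : Type := R * 'X_{1..n}.

(* Among terms of equal weight, the one with the larger exponent is the smaller. *)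
Definition kle : rel key :=
  fun a b => (a.1 < b.1) || ((a.1 == b.1) && ord b.2 a.2).

Definition klt : rel key := fun a b => (a != b) && kle a b.

Lemma kle_refl : reflexive kle.
Proof. by move=> a; rewrite /kle eqxx tle_refl orbT. Qed.

Lemma kle_total : total kle.
Proof.
move=> a b; rewrite /kle; case: ltgtP => //= _.
by rewrite orbC tle_total.
Qed.

Lemma kle_trans : transitive kle.
Proof.
move=> b a c; rewrite /kle => /orP[ab|/andP[/eqP-> ab]] /orP[bc|/andP[/eqP<- bc]].
- by rewrite (lt_trans ab bc).
- by rewrite ab.
- by rewrite bc.
- by rewrite eqxx (tle_trans bc ab) orbT.
Qed.

Lemma kle_anti : antisymmetric kle.
Proof.
move=> [a u] [b u'] /=; rewrite /kle /=; case: ltgtP => //= -> /tle_anti ->.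
by [].
Qed.

Lemma kltNge a b : klt a b = ~~ kle b a.
Proof.
rewrite /klt; case: eqVneq => [->|ab]; first by rewrite kle_refl.
case: (boolP (kle a b)) => [kab|nab] /=; last first.
  by have := kle_total a b; rewrite (negPf nab) /= => ->.
by apply/esym/negP => kba; case/eqP: ab; apply: kle_anti; rewrite kab.
Qed.

Lemma klt_kle_trans b a c : klt a b -> kle b c -> klt a c.
Proof. by rewrite !kltNge => nba bc; apply: contra nba; apply: kle_trans. Qed.

(** The action on keys of multiplication by a term with coefficient [c] and exponent [b], taking
    [v c + mweight b] as first argument. *)
Definition kshift (x : R) b (a : key) : key := (x + a.1, (b + a.2)%MM).

Lemma kshift_inj x b : injective (kshift x b).
Proof.
move=> [a u] [a' u'] /eqP; rewrite xpair_eqE eqm_add2l (inj_eq (addrI x)) /=.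
by case/andP=> /eqP-> /eqP->.
Qed.

Lemma kle_shift x b a a' : kle a a' -> kle (kshift x b a) (kshift x b a').
Proof.
rewrite /kle /= ltrD2l (inj_eq (addrI x)) => /orP[->//|/andP[-> o]].
by rewrite ![(b + _)%MM]addmC tleD2r // orbT.
Qed.

Lemma klt_shift x b a a' : klt a a' -> klt (kshift x b a) (kshift x b a').
Proof.
by case/andP=> ne /(kle_shift x b) le; rewrite /klt (inj_eq (@kshift_inj _ _)) ne.
Qed.

Lemma kle_shift_w x y b a : x <= y -> kle (kshift x b a) (kshift y b a).
Proof.
rewrite /kle /= ltrD2r (inj_eq (addIr _)) le_eqVlt => /orP[/eqP->|->//].
by rewrite eqxx tle_refl orbT.
Qed.

Definition tkey c u : key := (term_weight c u, u).

Lemma tkey_scale c a b u : c != 0 -> a != 0 ->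
  tkey (c * a) (b + u)%MM = kshift (v c + mweight b) b (tkey a u).
Proof.
move=> c0 a0; rewrite /tkey /kshift /= /Defs.term_weight -/(mweight _) -/(mweight _).
by rewrite valuationM // mweightD addrACA.
Qed.

Lemma kle_tkey a c u : kle (tkey a u) (tkey c u) = (v a <= v c).
Proof.
rewrite /kle /= /Defs.term_weight ltrD2r (inj_eq (addIr _)) tle_refl andbT.
by rewrite orbC -le_eqVlt.
Qed.

Lemma tkeyN a u : a != 0 -> tkey (- a) u = tkey a u.
Proof. by move=> a0; rewrite /tkey /Defs.term_weight valuationN. Qed.

Lemma trop_weightP f : f != 0 ->
  (exists2 u, u \in msupp f & trop_weight f = term_weight f@_u u) /\
  {in msupp f, forall u, trop_weight f <= term_weight f@_u u}.
Proof.
move=> f0; rewrite /Defs.trop_weight; set x0 := term_weight _ _.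
have H (s : seq 'X_{1..n}) : let m := \big[Num.min/x0]_(u <- s) term_weight f@_u u in
  (m = x0 \/ exists2 u, u \in s & m = term_weight f@_u u) /\
  {in s, forall u, m <= term_weight f@_u u}.
  elim: s => [|a s [Hex Hle]] /=; first by rewrite big_nil; split; [left|].
  rewrite big_cons; set m := \big[_/_]_(_ <- _) _ in Hex Hle *; split; last first.
    move=> u; rewrite inE ge_min => /predU1P[->|/Hle ->]; first by rewrite lexx.
    by rewrite orbT.
  case: (leP (term_weight f@_a a) m) => _; first by right; exists a; rewrite ?mem_head.
  by case: Hex => [->|[u us ->]]; [left | right; exists u; rewrite ?inE ?us ?orbT].
have [[->|//] Hle] := H (msupp f); split=> //.
by exists (mlead f); rewrite ?mlead_supp.
Qed.

Lemma mcoeff_in_w f u : (in_w f)@_u =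
  if (u \in msupp f) && (term_weight f@_u u == trop_weight f)
  then residue v (t (- v f@_u) * f@_u) else 0.
Proof.
rewrite /Defs.in_w raddf_sum /=.
rewrite (eq_bigr (fun u' => if u' == u then residue v (t (- v f@_u) * f@_u) else 0)); last first.
  move=> u' _; rewrite mcoeffZ mcoeffX; case: eqP => [->|_]; by rewrite ?mulr1 ?mulr0.
case: (boolP (u \in msupp f)) => [us|nus] /=; last first.
  by rewrite big_seq_cond big1 // => u' /andP[us' _]; case: eqP us' nus => // -> ->.
rewrite big_mkcond (bigD1_seq u) ?msupp_uniq //= eqxx big1 ?addr0 // => u' /negPf ->.
by rewrite if_same.
Qed.

Lemma splitting_unit c : c != 0 ->
  t (- v c) * c != 0 /\ v (t (- v c) * c) = 0.
Proof.
move=> c0; have G : value_group v (- v c) by apply/value_groupN/value_groupE.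
by rewrite mulf_neq0 ?splitting_neq0 // valuationM ?splitting_neq0 // splittingK // addNr.
Qed.

(** The rescaled coefficients have valuation exactly 0, hence nonzero residues: no term of minimal
    weight is lost in the residue field. *)
Lemma msupp_in_w f u : (u \in msupp (in_w f)) =
  (u \in msupp f) && (term_weight f@_u u == trop_weight f).
Proof.
rewrite mcoeff_msupp mcoeff_in_w; case: ifP; last by rewrite eqxx.
rewrite mcoeff_msupp => /andP[fu _]; have [c0 c1] := splitting_unit fu.
by rewrite residue_unit.
Qed.

Lemma in_w_eq0 f : (in_w f == 0) = (f == 0).
Proof.
have [->|f0] := eqVneq f 0.
  by rewrite /Defs.in_w msupp0 big_nil eqxx.
have [[u us tw] _] := trop_weightP f0.
apply/negbTE; rewrite -msupp_eq0; apply/eqP => s0.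
by have := msupp_in_w f u; rewrite s0 us -tw eqxx.
Qed.

Lemma lm_in_w f : f != 0 -> lm f \in msupp (in_w f).
Proof. by move=> f0; apply: lexp_supp; rewrite in_w_eq0. Qed.

Lemma lm_supp f : f != 0 -> lm f \in msupp f.
Proof. by move/lm_in_w; rewrite msupp_in_w => /andP[]. Qed.

Lemma lc_neq0 f : f != 0 -> lc f != 0.
Proof. by move/lm_supp; rewrite mcoeff_msupp. Qed.

Lemma lweightE f : f != 0 -> lweight f = trop_weight f.
Proof. by move/lm_in_w; rewrite msupp_in_w => /andP[_ /eqP]. Qed.

Lemma lcE f : lc f = f@_(lm f).
Proof. by []. Qed.

Lemma lweight_lc f : lweight f = v (lc f) + mweight (lm f).
Proof. by []. Qed.

Definition lkey f : key := (lweight f, lm f).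

Lemma lkeyE f : lkey f = tkey f@_(lm f) (lm f).
Proof. by []. Qed.

(** The initial form collects the terms of least weight and [lexp] takes the largest exponent among
    them; the reversed tie-break of [kle] turns these two choices into a single minimum. *)
Lemma lkey_min f u : u \in msupp f -> kle (lkey f) (tkey f@_u u).
Proof.
move=> us; have f0 : f != 0 by apply: contraTneq us => ->; rewrite msupp0.
have [_ /(_ _ us)] := trop_weightP f0; rewrite /kle /= -lweightE // le_eqVlt.
case/orP=> [e|->//]; rewrite e; apply/orP; right.
by apply: lexp_max; rewrite msupp_in_w us -lweightE // eq_sym.
Qed.

Lemma lkeyP f u : u \in msupp f ->
  {in msupp f, forall u', kle (tkey f@_u u) (tkey f@_u' u')} ->
  lkey f = tkey f@_u u.
Proof.
move=> us uP; apply: kle_anti; rewrite lkey_min //= lkeyE uP // lm_supp //.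
by apply: contraTneq us => ->; rewrite msupp0.
Qed.

(** For nonzero [f] this is [kle k (lkey f)]. Quantifying over the support makes it vacuous at [0],
    so that it is stable under sums even when they cancel. *)
Definition lbound (k : key) f : Prop := forall u, u \in msupp f -> kle k (tkey f@_u u).

Lemma lbound0 k : lbound k 0.
Proof. by move=> u; rewrite msupp0. Qed.

Lemma lbound_lkey f : lbound (lkey f) f.
Proof. by move=> u; apply: lkey_min. Qed.

Lemma lboundE k f : f != 0 -> lbound k f <-> kle k (lkey f).
Proof.
move=> f0; split=> [B|kf u us]; first by rewrite lkeyE; apply/B/lm_supp.
exact: kle_trans kf (lkey_min us).
Qed.

Lemma lboundD k f g : lbound k f -> lbound k g -> lbound k (f + g).
Proof.
move=> Bf Bg u; rewrite mcoeff_msupp mcoeffD.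
have [fu|fu] := eqVneq f@_u 0.
  by rewrite fu add0r -mcoeff_msupp; apply: Bg.
have [gu|gu] := eqVneq g@_u 0.
  by rewrite gu addr0 -mcoeff_msupp; apply: Bf.
move=> s0; have := valuationD v fu gu s0.
rewrite ge_min -!(kle_tkey _ _ u) => /orP[]; apply: kle_trans.
  by apply: Bf; rewrite mcoeff_msupp.
by apply: Bg; rewrite mcoeff_msupp.
Qed.

Lemma lboundN k f : lbound k f -> lbound k (- f).
Proof.
move=> B u; rewrite (perm_mem (msuppN f)) mcoeffN => us.
by rewrite tkeyN -?mcoeff_msupp //; apply: B.
Qed.

Lemma lbound_sum k (T : eqType) (s : seq T) (F : T -> S) :
  (forall i, i \in s -> lbound k (F i)) -> lbound k (\sum_(i <- s) F i).
Proof.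
move=> B; rewrite big_seq; elim/big_ind: _ => //; [exact: lbound0|exact: lboundD].
Qed.

Lemma lboundZ k c b f : c != 0 -> lbound k f ->
  lbound (kshift (v c + mweight b) b k) (c *: ('X_[b] * f)).
Proof.
move=> c0 B u; rewrite mcoeff_msupp mcoeffZ mcoeffXM mulf_eq0 (negPf c0) /=.
case: ifP => [bu|_]; last by rewrite eqxx.
rewrite -[X in tkey _ X](submK bu) addmC => fu; rewrite tkey_scale //; apply: kle_shift.
by apply: B; rewrite mcoeff_msupp.
Qed.

Lemma lkeyZ c b f : c != 0 -> f != 0 ->
  lkey (c *: ('X_[b] * f)) = kshift (v c + mweight b) b (lkey f).
Proof.
move=> c0 f0; have E : (c *: ('X_[b] * f))@_(b + lm f) = c * lc f.
  by rewrite mcoeffZ mcoeffXMD.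
rewrite (@lkeyP _ (b + lm f)%MM); rewrite ?mcoeff_msupp E.
- by rewrite tkey_scale ?lc_neq0 // lkeyE.
- by rewrite mulf_neq0 ?lc_neq0.
rewrite tkey_scale ?lc_neq0 // -lkeyE => u; apply: lboundZ => //.
exact: lbound_lkey.
Qed.

Lemma scaleXM_neq0 c b f : c != 0 -> f != 0 -> c *: ('X_[b] * f) != 0.
Proof.
move=> c0 f0; apply/eqP => /(congr1 (mcoeff (b + lm f)%MM)) /eqP.
by rewrite mcoeffZ mcoeffXMD mcoeff0 mulf_eq0 (negPf c0) /= (negPf (lc_neq0 f0)).
Qed.

Lemma lmX b f : f != 0 -> lm ('X_[b] * f) = (b + lm f)%MM.
Proof. by move=> f0; have := lkeyZ b (oner_neq0 K) f0; rewrite scale1r => -[]. Qed.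

Lemma lmZ c f : c != 0 -> f != 0 -> lm (c *: f) = lm f.
Proof.
move=> c0 f0; have := lkeyZ 0%MM c0 f0.
by rewrite mpolyX0 mul1r => -[_]; rewrite add0m.
Qed.

Local Opaque Defs.in_w lexp.

(** At [g = 0] both sides hold, in accordance with [0] being the largest polynomial. *)
Lemma pgeP f g : f != 0 -> reflect (lbound (lkey f) g) (pge t w ord g f).
Proof.
move=> f0; have [->|g0] := eqVneq g 0.
  by rewrite /pge /plt eqxx /=; left; apply: lbound0.
have -> : pge t w ord g f = kle (lkey f) (lkey g).
  rewrite -[RHS]negbK -kltNge /pge /plt g0 (negPf f0) /lkey /klt /kle /tlt xpair_eqE /=.
  move: (lweight g) (lweight f) (lm g) (lm f) => x y u u'.
  by case: ltgtP => //= _; rewrite eq_sym.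
have [lk kl] := lboundE (lkey f) g0; apply: (iffP idP) => H; first exact: kl.
exact: lk.
Qed.

Lemma pge_refl f : pge t w ord f f.
Proof. by rewrite /pge /plt ltxx eqxx /tlt eqxx orbF; case: eqP. Qed.

Lemma pge0 f : pge t w ord 0 f.
Proof. by rewrite /pge /plt eqxx. Qed.

Lemma pge_sum f (T : eqType) (s : seq T) (F : T -> S) :
  (forall i, i \in s -> pge t w ord (F i) f) -> pge t w ord (\sum_(i <- s) F i) f.
Proof.
have [-> P|f0 P] := eqVneq f 0; last first.
  by apply/(pgeP _ f0)/lbound_sum => i /P /(pgeP _ f0).
(* Only [0] is at least [0], so here every summand vanishes. *)
rewrite big_seq big1 ?pge_refl // => i /P; rewrite /pge /plt eqxx /=.
by rewrite andbT negbK => /eqP.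
Qed.

End Keys.

(** * Linear reduction modulo polynomials with distinct leading exponents *)

Section Reduction.
Context (R : realType) (K : fieldType) (v : valuation R K) (t : splitting v).
Context (n : nat) (w : 'rV[R]_n) (ord : term_order n).

Local Notation S := {mpoly K[n]}.
Local Notation lm := (lm t w ord).
Local Notation lkey := (lkey t w ord).
Local Notation lbound := (lbound v w ord).
Local Notation kle := (kle ord).
Local Notation tkey := (tkey v w).

Local Opaque Defs.in_w lexp Defs.lm Defs.lweight Defs.lc.

Context (N : nat) (p : 'I_N -> S).
Context (p_neq0 : forall i, p i != 0).
Context (lm_p_inj : injective (fun i => lm (p i))).

(* The least of the summands [y i *: p i] is not cancelled: by distinctness of
   the leading exponents its leading term is strictly smaller than every other
   term with the same exponent. *)
Lemma expansion_bound (y : 'I_N -> K) (r : S) i :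
  (forall j, r@_(lm (p j)) = 0) -> y i != 0 ->
  let f := \sum_j y j *: p j + r in f != 0 /\ lbound (lkey f) (y i *: p i).
Proof.
move=> r0 yi f.
pose L := [seq j <- enum 'I_N | y j != 0].
have iL : i \in L by rewrite mem_filter yi mem_enum.
have Zneq0 j : y j != 0 -> y j *: p j != 0.
  by move=> yj; rewrite scaler_eq0 negb_or yj p_neq0.
have lmZp j : y j != 0 -> lm (y j *: p j) = lm (p j) by move=> yj; rewrite lmZ.
have [] := @seq_min _ (relpre (fun j => lkey (y j *: p j)) kle) L.
- by move=> j1 j2; apply: kle_total.
- by move=> j2 j1 j3; apply: kle_trans.
- by apply: contraTneq iL => ->.
move=> m; rewrite mem_filter => /andP[ym _] /= mP.
pose a := (y m *: p m)@_(lm (p m)).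
have a0 : a != 0 by rewrite /a -lmZp // lc_neq0 // Zneq0.
have lkm : lkey (y m *: p m) = tkey a (lm (p m)) by rewrite lkeyE lmZp.
(* The coefficient [a] is recovered from that of [f] by subtracting the other summands, [r]
   contributing nothing. One of these contributions has valuation at most [v a]. *)
pose T j := if j == m then f@_(lm (p m)) else - (y j *: p j)@_(lm (p m)).
have sumT : \sum_j T j = a.
  rewrite (bigD1 m isT) /= {1}/T eqxx.
  rewrite (eq_bigr (fun j => - (y j *: p j)@_(lm (p m)))); last first.
    by move=> j /negPf jm; rewrite /T jm.
  rewrite sumrN /f mcoeffD r0 addr0 raddf_sum (bigD1 m isT).
  exact: addrK.
have [j [_ Tj0 vT]] : exists j, [/\ j \in index_enum _, T j != 0 & v (T j) <= v (\sum_j T j)].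
  by apply: valuation_sum; rewrite sumT.
have kT : kle (tkey (T j) (lm (p m))) (lkey (y m *: p m)).
  by rewrite lkm kle_tkey -sumT.
have [jm|jm] := eqVneq j m; last first.
  move: Tj0 kT; rewrite /T (negPf jm) oppr_eq0 => Tj0 kT.
  have yj : y j != 0 by apply: contraNneq Tj0 => ->; rewrite scale0r mcoeff0.
  have kTj : kle (lkey (y j *: p j)) (tkey (y j *: p j)@_(lm (p m)) (lm (p m))).
    by apply: lkey_min; rewrite mcoeff_msupp.
  rewrite tkeyN // in kT.
  (* If the contribution comes from [j] other than [m], minimality of [m] forces equal keys, hence
     equal leading exponents. *)
  have: lkey (y j *: p j) = lkey (y m *: p m).
    apply: (kle_anti (ord := ord)); rewrite (kle_trans kTj kT) /=; apply: mP.
    by rewrite mem_filter yj mem_enum.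
  move/(congr1 snd); rewrite /= (lmZp _ yj) (lmZp _ ym) => /lm_p_inj/eqP.
  by rewrite (negPf jm).
(* Otherwise [f] itself has a term at [lm (p m)] whose key is at most that of the least summand. *)
move: Tj0 kT; rewrite /T jm eqxx => fm km.
have f0 : f != 0 by apply: contraNneq fm => ->; rewrite mcoeff0.
split; first exact: f0.
apply/(lboundE t); first exact: Zneq0.
apply: kle_trans (mP _ iL); apply: kle_trans km.
by apply: lkey_min; rewrite mcoeff_msupp.
Qed.

Definition lead_matrix : 'M[K]_N := \matrix_(i, j) (p i)@_(lm (p j)).

(** A row [y] of the kernel yields a combination [f] that vanishes at every leading exponent. Then
    [- f] is an admissible [r] in [expansion_bound], although the total is [0]. *)
Lemma lead_matrix_unit : lead_matrix \in unitmx.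
Proof.
rewrite -row_free_unit -kermx_eq0; apply/eqP/row_matrixP => k; rewrite row0.
set y := row k _; have yA : y *m lead_matrix = 0.
  by apply/sub_kermxP/row_sub.
apply/rowP => i; rewrite [RHS]mxE; apply/eqP; apply: contraT => yi.
pose f := \sum_j y 0 j *: p j.
have [] := @expansion_bound (fun j => y 0 j) (- f) i _ yi; last by rewrite subrr eqxx.
move=> j; move/rowP/(_ j): yA; rewrite [LHS]mxE [RHS]mxE /f mcoeffN raddf_sum /= => yA.
apply/eqP; rewrite oppr_eq0 -[X in _ == X]yA; apply/eqP.
by apply: eq_bigr => l _; rewrite mcoeffZ [lead_matrix _ _]mxE.
Qed.

Definition reduce_coef (f : S) : 'rV[K]_N :=
  (\row_j f@_(lm (p j))) *m invmx lead_matrix.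

Definition reduce (f : S) : S := f - \sum_i reduce_coef f 0 i *: p i.

Lemma reduce_coef_is_linear : linear reduce_coef.
Proof.
move=> a f g; rewrite /reduce_coef scalemxAl -mulmxDl; congr (_ *m _).
by apply/rowP => j; rewrite !mxE mcoeffD mcoeffZ.
Qed.

Lemma reduce_is_linear : linear reduce.
Proof.
move=> a f g; rewrite /reduce reduce_coef_is_linear scalerBr addrACA -opprD.
congr (_ - _); rewrite scaler_sumr -big_split /=; apply: eq_bigr => i _.
by rewrite !mxE scalerDl scalerA.
Qed.

Lemma reduce_lm f j : (reduce f)@_(lm (p j)) = 0.
Proof.
have: reduce_coef f *m lead_matrix = \row_j f@_(lm (p j)).
  by rewrite /reduce_coef mulmxKV ?lead_matrix_unit.
move/rowP/(_ j); rewrite !mxE /reduce mcoeffB => <-; rewrite raddf_sum /=.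
by apply/eqP; rewrite subr_eq0; apply/eqP/eq_bigr => i _; rewrite mcoeffZ !mxE.
Qed.

Lemma reduce_id f : (forall j, f@_(lm (p j)) = 0) -> reduce f = f.
Proof.
move=> f0; rewrite /reduce /reduce_coef; have -> : \row_j f@_(lm (p j)) = 0.
  by apply/rowP => j; rewrite !mxE f0.
by rewrite mul0mx big1 ?subr0 // => i _; rewrite mxE scale0r.
Qed.

Lemma reduce_p i : reduce (p i) = 0.
Proof.
rewrite /reduce /reduce_coef; have -> : \row_j (p i)@_(lm (p j)) = row i lead_matrix.
  by apply/rowP => j; rewrite !mxE.
rewrite -row_mul mulmxV ?lead_matrix_unit // row1.
rewrite (bigD1 i) //= mxE !eqxx scale1r big1 ?addr0 ?subrr // => j /negPf ji.
by rewrite mxE eqxx ji scale0r.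
Qed.

Lemma reduceK f : \sum_i reduce_coef f 0 i *: p i + reduce f = f.
Proof. by rewrite addrC subrK. Qed.

Lemma reduce_bound f i : reduce_coef f 0 i != 0 ->
  f != 0 /\ lbound (lkey f) (reduce_coef f 0 i *: p i).
Proof.
move=> ci; have := @expansion_bound (reduce_coef f 0) (reduce f) i (reduce_lm f) ci.
by rewrite reduceK.
Qed.

HB.instance Definition _ := GRing.isLinear.Build K S S _ reduce reduce_is_linear.

End Reduction.

(** * Normal forms *)

Section Division.
Context (R : realType) (K : fieldType) (v : valuation R K) (t : splitting v).
Context (n : nat) (w : 'rV[R]_n) (ord : term_order n).

Local Notation S := {mpoly K[n]}.
Local Notation lm := (lm t w ord).
Local Notation lc := (lc t w ord).
Local Notation lkey := (lkey t w ord).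
Local Notation lbound := (lbound v w ord).
Local Notation kle := (kle ord).
Local Notation klt := (klt ord).
Local Notation tkey := (tkey v w).
Local Notation mweight := (mweight w).

Local Opaque Defs.in_w lexp Defs.lm Defs.lweight Defs.lc.

Implicit Types (f g h : S) (u b : 'X_{1..n}).

(** The multiples of [g] by the monomials of [h] have distinct leading exponents, so
    [expansion_bound] with [r = 0] shows that no summand of [h * g] starts below the product. *)
Lemma lkey_mul_le h g u : g != 0 -> u \in msupp h ->
  kle (lkey (h * g)) (lkey (h@_u *: ('X_[u] * g))).
Proof.
move=> g0 uh; pose N := size (msupp h); pose e (i : 'I_N) := nth 0%MM (msupp h) i.
pose p i : S := 'X_[e i] * g.
have p0 i : p i != 0 by have := scaleXM_neq0 t w ord (e i) (oner_neq0 K) g0; rewrite scale1r.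
have lmp i : lm (p i) = (e i + lm g)%MM by rewrite lmX.
have lm_inj : injective (fun i => lm (p i)).
  move=> i j; rewrite !lmp => /addIm /eqP.
  by rewrite nth_uniq ?msupp_uniq // => /eqP /val_inj.
have uN : (index u (msupp h) < N)%N by rewrite index_mem.
pose i := Ordinal uN; have ei : e i = u by rewrite /e nth_index.
have yi : h@_(e i) != 0 by rewrite ei -mcoeff_msupp.
have hgE : \sum_i h@_(e i) *: p i + 0 = h * g.
  rewrite addr0 {2}[h]mpolyE mulr_suml (big_nth 0%MM) big_mkord.
  by apply: eq_bigr => j _; rewrite scalerAl.
have [] := @expansion_bound _ _ _ t _ w ord _ p p0 lm_inj (fun i => h@_(e i)) 0 i _ yi.
  by move=> j; rewrite mcoeff0.
rewrite hgE => hg0; rewrite ei /p ei => B.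
have uh0 : h@_u != 0 by rewrite -mcoeff_msupp.
by apply/(lboundE t) => //; apply: (scaleXM_neq0 t w ord u uh0 g0).
Qed.

Lemma dhomog_lm g : g != 0 -> homogeneous g -> g \is (mdeg (lm g)).-homog.
Proof.
by move=> g0 [d gd]; rewrite ((dhomogP _ _ _ gd) (lm g)) //; apply: lm_supp.
Qed.

Lemma dhomogXM b g : g != 0 -> homogeneous g ->
  'X_[b] * g \is (mdeg (b + lm g)).-homog.
Proof.
move=> g0 gh; rewrite mdegD; apply: dhomogM (dhomog_lm g0 gh).
by rewrite dhomogX.
Qed.

Section Multiples.
Context (G : seq S) (G_neq0 : forall g, g \in G -> g != 0)
  (G_homog : forall g, g \in G -> homogeneous g) (d : nat).

(** Filtering the finite type of exponents of degree at most [d] yields a duplicate-free list, which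
    can index the square system of the reduction. *)
Definition lead_multiples : seq 'X_{1..n} :=
  [seq u <- [seq val b | b : 'X_{1..n < d.+1}] | (mdeg u == d) && has (fun g => (lm g <= u)%MM) G].

Lemma mem_lead_multiples u : (u \in lead_multiples) =
  (mdeg u == d) && has (fun g => (lm g <= u)%MM) G.
Proof.
rewrite mem_filter andb_idr // => /andP[/eqP ud _].
have ud' : (mdeg u < d.+1)%N by rewrite ud.
by apply/mapP; exists (BMultinom ud'); rewrite ?mem_enum.
Qed.

Lemma lead_multiples_uniq : uniq lead_multiples.
Proof.
by apply: filter_uniq; rewrite map_inj_uniq ?enum_uniq //; apply: val_inj.
Qed.

(** A single divisor is chosen for each exponent, so that the resulting multiples have distinct
    leading exponents. *)
Definition lead_index u : nat := find (fun g => (lm g <= u)%MM) G.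

Definition lead_multiple (i : 'I_(size lead_multiples)) : S :=
  let u := (nth 0%MM lead_multiples i) in
  let g := G`_(lead_index u) in 'X_[u - lm g] * g.

Lemma lead_indexP (i : 'I_(size lead_multiples)) :
  let u := (nth 0%MM lead_multiples i) in
  [/\ mdeg u = d, (lead_index u < size G)%N & (lm G`_(lead_index u) <= u)%MM].
Proof.
move=> u; have: u \in lead_multiples by apply: mem_nth.
rewrite mem_lead_multiples => /andP[/eqP ud hasu].
by split=> //; [rewrite -has_find | apply: (nth_find 0 hasu)].
Qed.

Lemma lm_lead_multiple i : lm (lead_multiple i) = (nth 0%MM lead_multiples i).
Proof.
have [_ iG dv] := lead_indexP i.
by rewrite /lead_multiple lmX ?submK //; apply/G_neq0/mem_nth.
Qed.

Lemma lead_multiple_neq0 i : lead_multiple i != 0.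
Proof.
have [_ iG dv] := lead_indexP i; have := scaleXM_neq0 t w ord
  ((nth 0%MM lead_multiples i) - lm G`_(lead_index (nth 0%MM lead_multiples i)))
  (oner_neq0 K) (G_neq0 (mem_nth 0 iG)).
by rewrite scale1r.
Qed.

Lemma lm_lead_multiple_inj : injective (fun i => lm (lead_multiple i)).
Proof.
move=> i j; rewrite !lm_lead_multiple => /eqP.
by rewrite nth_uniq ?lead_multiples_uniq // => /eqP /val_inj.
Qed.

Lemma lead_multiple_homog i : lead_multiple i \is d.-homog.
Proof.
have [<- iG dv] := lead_indexP i; rewrite -[X in mdeg X](submK dv).
by apply: dhomogXM; [apply: G_neq0 | apply: G_homog]; apply: mem_nth.
Qed.

Local Notation reduce := (reduce t w ord lead_multiple).
Local Notation reduce_coef := (reduce_coef t w ord lead_multiple).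

Lemma reduce_dhomog f : f \is d.-homog -> reduce f \is d.-homog.
Proof.
move=> fd; apply: rpredB => //; apply: rpred_sum => i _.
by apply/rpredZ/lead_multiple_homog.
Qed.

Lemma reduce_lead_multiples f u : u \in lead_multiples -> (reduce f)@_u = 0.
Proof.
move=> uM; have uN : (index u lead_multiples < size lead_multiples)%N by rewrite index_mem.
rewrite -(nth_index 0%MM uM) -(lm_lead_multiple (Ordinal uN)).
by apply: reduce_lm; [apply: lead_multiple_neq0 | apply: lm_lead_multiple_inj].
Qed.

Lemma pge_reduce_coef f i : pge t w ord (reduce_coef f 0 i *: lead_multiple i) f.
Proof.
have [->|ci] := eqVneq (reduce_coef f 0 i) 0; first by rewrite scale0r pge0.
have [f0 B] := reduce_bound lead_multiple_neq0 lm_lead_multiple_inj ci.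
exact/pgeP.
Qed.

Lemma pge_reduce f : pge t w ord (reduce f) f.
Proof.
have [->|f0] := eqVneq f 0; first by rewrite linear0 pge0.
apply/pgeP => //; apply: lboundD; first exact: lbound_lkey.
by apply/lboundN/lbound_sum => i _; apply/pgeP/pge_reduce_coef.
Qed.

Lemma dhomog_normal_form f : f \is d.-homog -> normal_form t w ord G f (reduce f).
Proof.
move=> fd; split; first by exists d; apply: reduce_dhomog.
pose c j := reduce_coef f 0 j.
pose at_ (i : nat) := [pred j : 'I_(size lead_multiples) |
  lead_index (nth 0%MM lead_multiples j) == i].
(* The multiples built from the same divisor are gathered into its quotient. *)
exists (fun i : 'I_(size G) =>
  \sum_(j | at_ i j) c j *: 'X_[(nth 0%MM lead_multiples j) - lm G`_i]).
have hE (i : 'I_(size G)) :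
    (\sum_(j | at_ i j) c j *: 'X_[(nth 0%MM lead_multiples j) - lm G`_i]) * G`_i
    = \sum_j if at_ i j then c j *: lead_multiple j else 0.
  rewrite mulr_suml -big_mkcond; apply: eq_bigr => j /eqP ji.
  by rewrite -scalerAl /lead_multiple ji.
split.
- move=> i; have Gi : G`_i \in G by apply: mem_nth.
  exists (d - mdeg (lm G`_i))%N; apply: rpred_sum => j /eqP ji.
  have [ud iG dv] := lead_indexP j; apply: rpredZ; rewrite dhomogX /=.
  by rewrite -ud -{2}(submK dv) ji mdegD addnK.
- rewrite -{1}[f](reduceK t w ord lead_multiple f); congr (_ + _).
  rewrite (eq_bigr _ (fun i _ => hE i)) exchange_big /=.
  apply: eq_bigr => j _; rewrite -big_mkcond /=.
  have [_ iG _] := lead_indexP j; rewrite (big_pred1 (Ordinal iG)) //.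
- move=> i; rewrite hE; apply: pge_sum => j _; case: ifP => _; last exact: pge0.
  exact: pge_reduce_coef.
- exact: pge_reduce.
move=> u us i; apply: contraTN us => dv; rewrite mcoeff_msupp negbK.
(* A divisible exponent of degree [d] is one of [lead_multiples], where the reduction vanishes; in
   other degrees the reduction has no terms. *)
have [ud|ud] := eqVneq (mdeg u) d; last first.
  by apply/eqP/(dhomog_nemf_coeff (reduce_dhomog fd)).
apply/eqP/reduce_lead_multiples; rewrite mem_lead_multiples ud eqxx /=.
by apply/hasP; exists G`_i => //; apply: mem_nth.
Qed.

End Multiples.

Lemma normal_form_exists (G : seq S) f :
  (forall g, g \in G -> g != 0) -> (forall g, g \in G -> homogeneous g) ->
  homogeneous f -> exists r, normal_form t w ord G f r.
Proof.
by move=> G0 Gh [d fd]; eexists; apply: (dhomog_normal_form G0 Gh fd).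
Qed.

End Division.

(** * The S-pair criterion *)

Section Criterion.
Context (R : realType) (K : fieldType) (v : valuation R K) (t : splitting v).
Context (n : nat) (w : 'rV[R]_n) (ord : term_order n).

Local Notation S := {mpoly K[n]}.
Local Notation lm := (lm t w ord).
Local Notation lc := (lc t w ord).
Local Notation lkey := (lkey t w ord).
Local Notation lbound := (lbound v w ord).
Local Notation kle := (kle ord).
Local Notation klt := (klt ord).
Local Notation tkey := (tkey v w).
Local Notation mweight := (mweight w).
Local Notation spoly := (spoly t w ord).

Local Opaque Defs.in_w lexp Defs.lm Defs.lweight Defs.lc.
Local Opaque mlcm mnm_add mnm_sub.

Implicit Types (f g h : S) (u b : 'X_{1..n}).

(** The common leading key of the two summands of [spoly g g'], before they cancel. *)
Definition spoly_key g g' : key R n :=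
  (v (lc g) + v (lc g') + mweight (mlcm (lm g) (lm g')), mlcm (lm g) (lm g')).

Lemma spolyC g g' : spoly g' g = - spoly g g'.
Proof.
rewrite /Defs.spoly opprB (mlcmC (lm g')).
by move: (lm g) (lm g') (lc g) (lc g') (mlcm _ _) => *.
Qed.

Lemma spoly_keyC g g' : spoly_key g' g = spoly_key g g'.
Proof.
rewrite /spoly_key (mlcmC (lm g')); move: (mlcm _ _) => m.
by rewrite [v (lc g') + _]addrC.
Qed.

Lemma spoly_shift g g' u : (mlcm (lm g) (lm g') <= u)%MM ->
  'X_[u - mlcm (lm g) (lm g')] * spoly g g' =
  lc g' *: ('X_[u - lm g] * g) - lc g *: ('X_[u - lm g'] * g').
Proof.
move: (lem_mlcml (lm g) (lm g')) (lem_mlcmr (lm g) (lm g')); rewrite /Defs.spoly.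
move: (lc g) (lc g') (lm g) (lm g') (mlcm _ _) => a a' e e' m em e'm le_u.
have E e1 : (e1 <= m)%MM -> (u - m + (m - e1) = u - e1)%MM.
  by move=> le_m; rewrite addmBA // submK.
by rewrite mulrBr -!scalerAr !mulrA -!mpolyXD (E e em) (E e' e'm).
Qed.

Lemma lkey_spoly_summand g g' : g != 0 -> g' != 0 ->
  lkey (lc g' *: ('X_[mlcm (lm g) (lm g') - lm g] * g)) = spoly_key g g'.
Proof.
move=> g0 g'0; rewrite (lkeyZ t w ord _ (lc_neq0 t w ord g'0) g0) /kshift /spoly_key /= lweight_lc.
move: (lem_mlcml (lm g) (lm g')); move: (lm g) (mlcm _ _) => e m le_m.
rewrite submK //; congr (_, _); rewrite -[in RHS](submK le_m) mweightD.
by rewrite addrACA [v (lc g') + v _]addrC.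
Qed.

Lemma mcoeff_spoly g g' : (spoly g g')@_(mlcm (lm g) (lm g')) = 0.
Proof.
have E h e m : (e <= m)%MM -> ('X_[m - e] * h)@_m = h@_e.
  by move=> le_m; rewrite -[X in _@_X](submK le_m) mcoeffXMD.
rewrite /Defs.spoly mcoeffB !mcoeffZ (E _ _ _ (lem_mlcml _ _)) (E _ _ _ (lem_mlcmr _ _)).
by rewrite -!lcE mulrC subrr.
Qed.

(** Both summands start at [spoly_key], and their terms at the least common multiple cancel, so the
    exponent of that key can no longer be the leading one. *)
Lemma spoly_key_lt g g' : g != 0 -> g' != 0 -> spoly g g' != 0 ->
  klt (spoly_key g g') (lkey (spoly g g')).
Proof.
move=> g0 g'0 s0; rewrite /klt; apply/andP; split.
  apply/eqP => /(congr1 snd) /= E.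
  by have := lc_neq0 t w ord s0; rewrite lcE -E mcoeff_spoly eqxx.
apply/(lboundE t); first exact: s0.
apply: lboundD.
  by rewrite -(lkey_spoly_summand g0 g'0); apply: lbound_lkey.
apply: lboundN; rewrite -spoly_keyC mlcmC -(lkey_spoly_summand g'0 g0).
exact: lbound_lkey.
Qed.

(** This is what a vanishing normal form provides, without the homogeneity of the cofactors. It
    persists when the basis grows. *)
Definition std_rep (G : seq S) f : Prop := exists h : S -> S,
  f = \sum_(g <- G) h g * g /\ forall g, g \in G -> pge t w ord (h g * g) f.

(** One orientation of each pair is enough because exchanging [g] and [g'] only changes the sign of
    the S-polynomial; the algorithm queues new pairs in one orientation. *)
Lemma lm_multiple_of_std_rep (G : seq S) :
  (forall g, g \in G -> g != 0) -> (forall g, g \in G -> homogeneous g) ->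
  (forall g g', g \in G -> g' \in G ->
     std_rep G (spoly g g') \/ std_rep G (spoly g' g)) ->
  forall f, ideal_gen (fun g => g \in G) f -> f != 0 ->
  exists2 g, g \in G & (lm g <= lm f)%MM.
Proof.
move=> G0 Gh repG f If f0; pose u0 := lm f; pose d := mdeg u0.
apply/hasP; apply: contraT => ndiv.
pose M := lead_multiples t w ord G d.
pose p : 'I_(size M) -> S := @lead_multiple _ _ _ t _ w ord G d.
have p0 : forall i, p i != 0 := lead_multiple_neq0 G0 (d := d).
have p_inj : injective (fun i => lm (p i)) := lm_lead_multiple_inj G0 (d := d).
pose phi g := (reduce t w ord p g)@_u0.
have phiZ a g : phi (a *: g) = a * phi g by rewrite /phi linearZ mcoeffZ.
have phi0 : phi 0 = 0 by rewrite /phi linear0 mcoeff0.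
have phiN g : phi (- g) = - phi g by rewrite /phi linearN mcoeffN.
have phiD g h : phi (g + h) = phi g + phi h.
  by rewrite /phi -mcoeffD -[in RHS](linearD (reduce t w ord p)).
have phiB g h : phi (g - h) = phi g - phi h by rewrite phiD phiN.
have phi_sum (T : Type) (s : seq T) (F : T -> S) :
    phi (\sum_(i <- s) F i) = \sum_(i <- s) phi (F i).
  by rewrite /phi linear_sum raddf_sum.
(* A multiple of another degree has no terms at [u0] or at the exponents in [M]; it is its own
   reduction, and [phi] kills it. *)
have phi_deg b g : g \in G -> phi ('X_[b] * g) != 0 -> mdeg (b + lm g) = d.
  move=> gG; apply: contraNeq => nd; have hom := dhomogXM t w ord b (G0 _ gG) (Gh _ gG).
  have nemf u : mdeg u = d -> ('X_[b] * g)@_u = 0.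
    by move=> ud; apply: (dhomog_nemf_coeff hom); rewrite /= ud eq_sym.
  have -> : phi ('X_[b] * g) = ('X_[b] * g)@_u0.
    congr mcoeff; apply: reduce_id => j; apply: nemf.
    by rewrite (lm_lead_multiple G0); have [] := lead_indexP j.
  by apply/eqP/nemf.
(* By [phi_deg] only finitely many multiples escape [phi], so a maximum over them exists. *)
pose Q := [seq q <- [seq (val c, g) | c <- enum {: 'X_{1..n < d.+1}}, g <- G]
          | phi ('X_[q.1] * q.2) != 0].
have memQ b g : g \in G -> phi ('X_[b] * g) != 0 -> (b, g) \in Q.
  move=> gG nz; rewrite mem_filter nz /=.
  have bd : (mdeg b < d.+1)%N by rewrite ltnS -(phi_deg _ _ gG nz) mdegD leq_addr.
  by apply/allpairsP; exists (BMultinom bd, g); rewrite mem_enum.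
pose nkey (q : 'X_{1..n} * S) := lkey ((phi ('X_[q.1] * q.2))^-1 *: ('X_[q.1] * q.2)).
have phiX0 b g : g \in G -> phi ('X_[b] * g) = 0.
  move=> gG; apply/eqP; apply: contraT => nz; exfalso.
  (* The relation is reversed, so the minimum found is a multiple of largest normalised key. *)
  have [] := @seq_min _ (relpre nkey (fun k1 k2 => kle k2 k1)) Q.
  - by move=> q1 q2; apply: kle_total.
  - by move=> q2 q1 q3 /= h12 h23; apply: kle_trans h23 h12.
  - by apply: contraTneq (memQ _ _ gG nz) => ->.
  move=> {b g gG nz} [b g]; rewrite mem_filter /= => /andP[nz].
  case/allpairsP => -[b' g1] /= [_ gG [_ eg]]; rewrite -{}eg in gG => Qmax.
  pose u := (b + lm g)%MM; have ud : mdeg u = d := phi_deg _ _ gG nz.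
  have uM : u \in M.
    rewrite mem_lead_multiples ud eqxx; apply/hasP; exists g => //; exact: lem_addl.
  have uN : (index u M < size M)%N by rewrite index_mem.
  pose j := Ordinal uN; pose g' := G`_(lead_index t w ord G u).
  have eu : nth 0%MM M j = u by rewrite nth_index.
  have [_ jG jdv] := lead_indexP j; rewrite -/M eu -/g' in jG jdv.
  have g'G : g' \in G by apply: mem_nth.
  have pj : p j = 'X_[u - lm g'] * g' by rewrite /p /lead_multiple -/M eu.
  have phi_pj : phi ('X_[u - lm g'] * g') = 0.
    by rewrite -pj /phi reduce_p ?mcoeff0.
  have g0 := G0 _ gG; have g'0 := G0 _ g'G.
  pose m := mlcm (lm g) (lm g').
  have m_u : (m <= u)%MM by rewrite lem_mlcm jdv lem_addl.
  (* The multiples of [g] and [g'] share the leading exponent [u], so their cross-scaled difference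
     is a shifted S-polynomial. Only the multiple of [g] contributes, since the other one is
     [p j]. *)
  have phi_s : phi ('X_[u - m] * spoly g g') = lc g' * phi ('X_[b] * g).
    rewrite spoly_shift // phiB !phiZ phi_pj mulr0 subr0.
    by rewrite /u addmK.
  (* Here [s] is whichever orientation of the S-polynomial has a representation; the sign affects
     neither valuations nor keys. *)
  have [s [rep_s phi_s_nz v_phi_s klt_s]] : exists s, [/\ std_rep G s,
      phi ('X_[u - m] * s) != 0,
      v (phi ('X_[u - m] * s)) = v (lc g') + v (phi ('X_[b] * g))
      & klt (spoly_key g g') (lkey s)].
    have lcphi0 : lc g' * phi ('X_[b] * g) != 0 by rewrite mulf_neq0 ?lc_neq0.
    have s0 : spoly g g' != 0.
      by apply: contraNneq lcphi0 => s0; rewrite -phi_s s0 mulr0 phi0.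
    have vE : v (lc g' * phi ('X_[b] * g)) = v (lc g') + v (phi ('X_[b] * g)).
      by rewrite valuationM ?lc_neq0.
    case: (repG _ _ gG g'G) => rep.
      exists (spoly g g'); split; rewrite ?phi_s //; exact: spoly_key_lt.
    have phi_s' : phi ('X_[u - m] * spoly g' g) = - (lc g' * phi ('X_[b] * g)).
      by rewrite spolyC mulrN phiN phi_s.
    exists (spoly g' g); split; rewrite ?phi_s' ?oppr_eq0 ?valuationN //.
    by rewrite -spoly_keyC; apply: spoly_key_lt; rewrite // spolyC oppr_eq0.
  case: rep_s => h [sE hge].
  have s0 : s != 0.
    by apply: contraNneq phi_s_nz => ->; rewrite mulr0 phi0.
  (* Two selections, of a product [h g2 * g2] and then of a term of [h g2], keep the value of [phi]
     nonzero without raising its valuation. *)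
  have [g2 [g2G nz2 v2]] : exists g2, [/\ g2 \in G, phi ('X_[u - m] * (h g2 * g2)) != 0 &
      v (phi ('X_[u - m] * (h g2 * g2))) <= v (phi ('X_[u - m] * s))].
    have E : phi ('X_[u - m] * s) = \sum_(g2 <- G) phi ('X_[u - m] * (h g2 * g2)).
      by rewrite sE mulr_sumr phi_sum.
    by rewrite E; apply: valuation_sum; rewrite -E.
  have [c [ch nz3 v3]] : exists c, [/\ c \in msupp (h g2),
      (h g2)@_c * phi ('X_[u - m + c] * g2) != 0 &
      v ((h g2)@_c * phi ('X_[u - m + c] * g2)) <= v (phi ('X_[u - m] * (h g2 * g2)))].
    have E : phi ('X_[u - m] * (h g2 * g2)) =
        \sum_(c <- msupp (h g2)) (h g2)@_c * phi ('X_[u - m + c] * g2).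
      rewrite {1}[h g2]mpolyE mulr_suml mulr_sumr phi_sum; apply: eq_bigr => c _.
      by rewrite -scalerAl -scalerAr phiZ mulrA mpolyXD.
    by rewrite E; apply: valuation_sum; rewrite -E.
  have g20 := G0 _ g2G.
  set x := (h g2)@_c * phi ('X_[u - m + c] * g2) in nz3 v3.
  have hc0 : (h g2)@_c != 0 by rewrite -mcoeff_msupp.
  have ph0 : phi ('X_[u - m + c] * g2) != 0.
    by apply: contraNneq nz3; rewrite /x => ->; rewrite mulr0.
  pose a := (h g2)@_c *: ('X_[c] * g2).
  have a0 : a != 0 by apply: (scaleXM_neq0 t w ord).
  have klt_a : klt (spoly_key g g') (lkey a).
    apply: klt_kle_trans klt_s _; apply: kle_trans (lkey_mul_le t w ord g20 ch).
    have hg0 : h g2 * g2 != 0.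
      by apply: contraNneq nz2 => ->; rewrite mulr0 phi0.
    by apply/(lboundE t) => //; apply/pgeP => //; apply: hge.
  have Qmax' := Qmax _ (memQ _ _ g2G ph0).
  (* Both normalised keys are shifts by [u - m], one of [lkey a], the other of [spoly_key g g']. The
     first has the strictly larger key and at least as large a weight shift, against maximality. *)
  have nk2 : nkey ((u - m + c)%MM, g2) = kshift (- v x + mweight (u - m)) (u - m)%MM (lkey a).
    have xE : (phi ('X_[u - m + c] * g2))^-1 = x^-1 * (h g2)@_c.
      by rewrite /x invfM mulrAC mulVf // mul1r.
    have aE : (phi ('X_[u - m + c] * g2))^-1 *: ('X_[u - m + c] * g2)
        = x^-1 *: ('X_[u - m] * a).
      by rewrite /a xE -scalerAr scalerA mulrA -mpolyXD.
    have xV0 : x^-1 != 0 by rewrite invr_eq0.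
    by rewrite /nkey /fst /snd aE (lkeyZ t w ord _ xV0 a0) valuationV.
  have nk1 : nkey (b, g) = kshift (- v (lc g') - v (phi ('X_[b] * g)) + mweight (u - m))
      (u - m)%MM (spoly_key g g').
    have phV0 : (phi ('X_[b] * g))^-1 != 0 by rewrite invr_eq0.
    rewrite /nkey /fst /snd (lkeyZ t w ord _ phV0 g0) /kshift /spoly_key /= (submK m_u).
    congr (_, _); rewrite valuationV // lweight_lc -/m.
    have := mweightD w (u - m) m; rewrite submK // mweightD => uE.
    rewrite [RHS]addrACA -uE; ring.
  move: Qmax'; rewrite /= nk1 nk2; apply/negP; rewrite -kltNge.
  apply: klt_kle_trans (klt_shift _ _ klt_a) _; apply: kle_shift_w.
  rewrite lerD2r -opprD lerN2; apply: le_trans v3 _; apply: le_trans v2 _.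
  by rewrite v_phi_s.
have phif : phi f = 0.
  case: If => s [sG ->]; rewrite phi_sum big_seq big1 // => -[h g] /sG /= gG.
  rewrite [h]mpolyE mulr_suml phi_sum big1 // => c _.
  by rewrite -scalerAl phiZ phiX0 ?mulr0.
have fu0 : f@_u0 != 0 by rewrite -mcoeff_msupp lm_supp.
(* As [phi f = 0], the coefficient of [f] at [u0] comes from the [c i *: p i]. A summand responsible
   for its valuation is squeezed to the key of [f], which puts [u0] in [M]. *)
pose c i := reduce_coef t w ord p f 0 i.
have fE : \sum_i (c i *: p i)@_u0 = f@_u0.
  rewrite -[f in RHS](reduceK t w ord p f) mcoeffD -/(phi f) phif addr0.
  by rewrite raddf_sum.
have [i [_ ci0 vi]] : exists i, [/\ i \in index_enum _, (c i *: p i)@_u0 != 0 &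
    v (c i *: p i)@_u0 <= v (f@_u0)].
  by rewrite -fE; apply: valuation_sum; rewrite fE.
have ci : c i != 0 by apply: contraNneq ci0 => ->; rewrite scale0r mcoeff0.
have [_ B] := reduce_bound p0 p_inj ci.
have cp0 : c i *: p i != 0 by apply: contraNneq ci0 => ->; rewrite mcoeff0.
have k1 : kle (lkey f) (lkey (c i *: p i)) by apply/(lboundE t).
have k2 : kle (lkey (c i *: p i)) (tkey (c i *: p i)@_u0 u0).
  by apply: lkey_min; rewrite mcoeff_msupp.
have k3 : kle (tkey (c i *: p i)@_u0 u0) (lkey f).
  by rewrite lkeyE kle_tkey.
have : lkey (c i *: p i) = lkey f.
  by apply: (kle_anti (ord := ord)); rewrite k1 (kle_trans k2 k3).
move/(congr1 snd); rewrite /= lmZ // lm_lead_multiple // => ui.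
have : u0 \in M by rewrite /u0 -ui mem_nth.
by rewrite mem_lead_multiples (negPf ndiv) andbF.
Qed.

End Criterion.

(** * Initial ideals *)

Section IdealGen.
Context (A : comNzRingType).
Implicit Types (X Y : A -> Prop) (p q : A).

Lemma ideal_gen0 X : ideal_gen X 0.
Proof. by exists [::]; rewrite big_nil. Qed.

Lemma ideal_genD X p q : ideal_gen X p -> ideal_gen X q -> ideal_gen X (p + q).
Proof.
move=> [s [sX ->]] [s' [s'X ->]]; exists (s ++ s'); rewrite big_cat; split=> //.
by move=> x; rewrite mem_cat => /orP[/sX|/s'X].
Qed.

Lemma ideal_genM X a p : ideal_gen X p -> ideal_gen X (a * p).
Proof.
move=> [s [sX ->]]; exists [seq (a * x.1, x.2) | x <- s]; split.
  by move=> _ /mapP[x xs ->]; apply: (sX x).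
by rewrite big_map mulr_sumr; apply: eq_bigr => x _; rewrite mulrA.
Qed.

Lemma ideal_gen_sum X (T : eqType) (s : seq T) (F : T -> A) :
  (forall i, i \in s -> ideal_gen X (F i)) -> ideal_gen X (\sum_(i <- s) F i).
Proof.
move=> XF; rewrite big_seq.
by elim/big_ind: _ => //; [exact: ideal_gen0 | exact: ideal_genD].
Qed.

Lemma ideal_gen_mem X p : X p -> ideal_gen X p.
Proof.
move=> Xp; exists [:: (1, p)]; rewrite big_seq1 mul1r; split=> // x.
by rewrite inE => /eqP ->.
Qed.

Lemma ideal_gen_sub X Y : (forall p, X p -> ideal_gen Y p) ->
  forall p, ideal_gen X p -> ideal_gen Y p.
Proof.
move=> XY _ [s [sX ->]]; apply: ideal_gen_sum => x xs.
exact/ideal_genM/XY/sX.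
Qed.

End IdealGen.

Section InitialIdeal.
Context (R : realType) (K : fieldType) (v : valuation R K) (t : splitting v).
Context (n : nat) (w : 'rV[R]_n) (ord : term_order n).

Local Notation S := {mpoly K[n]}.
Local Notation Sk := {mpoly (residue_field v)[n]}.
Local Notation lm := (lm t w ord).
Local Notation lkey := (lkey t w ord).
Local Notation mweight := (mweight w).
Local Notation term_weight := (term_weight v w).

Implicit Types (f g h : S) (u b : 'X_{1..n}).

Lemma splitting0 : v (t 0) = 0.
Proof. by rewrite splittingK //; apply: value_group0. Qed.

(* [p] and [f] agree after reduction on the exponents whose weight lies in the
   class of [W] modulo the value group; [p] is unconstrained elsewhere. *)
Definition is_lift (W : R) (p : Sk) f : Prop :=
  (forall u, u \in msupp f -> W <= term_weight f@_u u) /\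
  (forall u, value_group v (W - mweight u) ->
     p@_u = residue v (t (mweight u - W) * f@_u)).

Lemma scaled_coef_valring W f u : value_group v (W - mweight u) ->
  (u \in msupp f -> W <= term_weight f@_u u) ->
  t (mweight u - W) * f@_u \in valuation_ring v.
Proof.
move=> Gu; rewrite valuation_ringE mulf_eq0 mcoeff_msupp.
have Gu' : value_group v (mweight u - W) by rewrite -opprB; apply: value_groupN.
have [->|fu /(_ isT) le_u] := eqVneq f@_u 0; first by rewrite orbT.
rewrite valuationM ?splitting_neq0 // splittingK // orbC.
by rewrite addrAC subr_ge0 addrC le_u.
Qed.

Lemma is_lift0 W : is_lift W 0 0.
Proof.
split=> u; first by rewrite msupp0.
by rewrite !mcoeff0 mulr0 residue0.
Qed.

Lemma is_liftD W p q f g : is_lift W p f -> is_lift W q g -> is_lift W (p + q) (f + g).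
Proof.
move=> [Wf pf] [Wg qg]; split=> u.
  rewrite mcoeff_msupp mcoeffD.
  have [fu|fu] := eqVneq f@_u 0.
    by rewrite fu add0r -mcoeff_msupp; apply: Wg.
  have [gu|gu] := eqVneq g@_u 0.
    by rewrite gu addr0 -mcoeff_msupp; apply: Wf.
  move=> s0; have := valuationD v fu gu s0; rewrite ge_min => /orP[] le_s.
    apply: le_trans (Wf u _) _; first by rewrite mcoeff_msupp.
    by rewrite lerD2r.
  apply: le_trans (Wg u _) _; first by rewrite mcoeff_msupp.
  by rewrite lerD2r.
move=> Gu; have fr := scaled_coef_valring Gu (Wf u).
have gr := scaled_coef_valring Gu (Wg u).
by rewrite !mcoeffD mulrDr (residueD fr gr) pf // qg.
Qed.

(** The initial weight [T] of [f] has to be moved to [W]. If [W - T - mweight b] is a value, a lift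
    of [a] times the corresponding power of [t] does it. If not, all exponents of the shifted
    initial form lie outside the class of [W], and [0] is a lift. *)
Lemma is_lift_in_w W (a : residue_field v) b f : f != 0 ->
  exists c : K, is_lift W (a *: ('X_[b] * in_w t w f)) (c *: ('X_[b] * f)).
Proof.
move=> f0; have [[u1 u1f tropE] trop_le] := trop_weightP v w f0.
set T := trop_weight v w f in tropE trop_le.
case: (pselect (value_group v (W - T - mweight b))) => [GT|nGT]; last first.
  exists 0; rewrite scale0r; split=> u; first by rewrite msupp0.
  move=> Gu; rewrite mcoeff0 mulr0 residue0 mcoeffZ mcoeffXM.
  case: ifP => [bu|_]; last by rewrite mulr0.
  rewrite mcoeff_in_w; case: ifP => [|_]; last by rewrite mulr0.
  case/andP; rewrite mcoeff_msupp => fu /eqP eT; case: nGT.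
  have -> : W - T - mweight b = (W - mweight u) - v f@_(u - b).
    have -> : mweight u = mweight (u - b) + mweight b by rewrite -mweightD submK.
    by rewrite -/T in eT; rewrite -eT /Defs.term_weight -/(mweight _); ring.
  by apply: value_groupD => //; apply/value_groupN/value_groupE.
have [->|a0] := eqVneq a 0.
  by exists 0; rewrite !scale0r; apply: is_lift0.
have [a' a'r aE] := residue_surj a.
have := a0; rewrite -aE residue_eq0 // negb_or -leNgt => /andP[a'0 va'].
have {}va' : v a' = 0.
  apply/eqP; rewrite eq_le va' /=; move: a'r; rewrite valuation_ringE (negPf a'0).
  by [].
have tT0 : t (W - T - mweight b) != 0 by apply: splitting_neq0.
pose c := a' * t (W - T - mweight b).
have c0 : c != 0 by rewrite mulf_neq0.
have vc : v c = W - T - mweight b by rewrite valuationM // va' add0r splittingK.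
have weightE u : f@_u != 0 -> term_weight (c * f@_u) (b + u)%MM = W + (term_weight f@_u u - T).
  move=> fu; rewrite /Defs.term_weight -!/(mweight _) valuationM // vc mweightD; ring.
exists c; split=> u.
  rewrite mcoeff_msupp mcoeffZ mcoeffXM; case: ifP => [bu|_]; last by rewrite mulr0 eqxx.
  rewrite mulf_eq0 negb_or => /andP[_ fu].
  rewrite -[X in term_weight _ X](submK bu) addmC weightE // lerDl subr_ge0.
  by apply: trop_le; rewrite mcoeff_msupp.
move=> Gu; rewrite !mcoeffZ !mcoeffXM; case: ifP => [bu|_]; last by rewrite !mulr0 residue0.
have uE : u = (b + (u - b))%MM by rewrite addmC submK.
move: (u - b)%MM uE => u' uE; rewrite {u bu}uE in Gu *; move: u' Gu => u Gu.
have Gu' : value_group v (mweight (b + u) - W).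
  by rewrite -opprB; apply: value_groupN.
rewrite mcoeff_in_w mcoeff_msupp; have [->|fu] := eqVneq f@_u 0.
  by rewrite /= !mulr0 residue0.
have nz : t (mweight (b + u) - W) * (c * f@_u) != 0.
  by rewrite !mulf_neq0 // splitting_neq0.
have vE : v (t (mweight (b + u) - W) * (c * f@_u)) = term_weight f@_u u - T.
  rewrite valuationM ?mulf_neq0 ?splitting_neq0 // splittingK //.
  have := weightE u fu; rewrite /Defs.term_weight -!/(mweight _).
  by move=> E; rewrite -[RHS](addKr W) -E; ring.
have in_ring : t (mweight (b + u) - W) * (c * f@_u) \in valuation_ring v.
  by rewrite valuation_ringE vE subr_ge0 trop_le ?orbT // mcoeff_msupp.
(* A term of weight above [T] acquires positive valuation and disappears in the residue field, as it
   does in [in_w f]. *)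
case: eqVneq => /= [eT|neT]; last first.
  rewrite mulr0; apply/esym/eqP; rewrite residue_eq0 // (negPf nz) vE subr_gt0.
  by rewrite lt_neqAle eq_sym neT trop_le // mcoeff_msupp.
have tE : t (- v f@_u) = t (mweight (b + u) - W) * t (W - T - mweight b).
  rewrite -splittingD //; congr (t _).
  by rewrite -/T in eT; rewrite -eT mweightD /Defs.term_weight -/(mweight _); ring.
rewrite -residueM //; last first.
  have [nz1 v1] := splitting_unit t fu.
  by rewrite valuation_ringE v1 lexx orbT.
by rewrite tE /c; congr residue; ring.
Qed.

(** For a fixed [W] lifts can be added, so the cofactors may be expanded into monomials and each
    multiple lifted separately. *)
Lemma in_w_ideal_lift (X : S -> Prop) W (p : Sk) :
  in_w_ideal t w (ideal_gen X) p ->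
  exists2 f, ideal_gen X f & is_lift W p f.
Proof.
pose L q := exists2 f, ideal_gen X f & is_lift W q f.
have L0 : L 0 by exists 0; [exact: ideal_gen0 | exact: is_lift0].
have LD q1 q2 : L q1 -> L q2 -> L (q1 + q2).
  move=> [f1 If1 l1] [f2 If2 l2]; exists (f1 + f2); first exact: ideal_genD.
  exact: is_liftD.
case=> s [sX ->]; rewrite big_seq -/(L _).
elim/big_ind: _ => // -[q1 q2] /sX [f [If f0 /= ->]].
rewrite [q1]mpolyE mulr_suml; elim/big_ind: _ => // b _.
have [c lift_c] := is_lift_in_w W q1@_b b f0.
exists (c *: ('X_[b] * f)); last by rewrite -scalerAl.
by rewrite -mul_mpolyC; do 2!apply: ideal_genM.
Qed.

(** Taking [W = mweight u0] puts the leading exponent [u0] of [p] in the class where the lift is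
    controlled. The lift then has a coefficient of valuation 0 at [u0], of the least possible weight
    [W]. *)
Lemma lexp_in_w_ideal (X : S -> Prop) (p : Sk) :
  in_w_ideal t w (ideal_gen X) p -> p != 0 ->
  exists f, [/\ ideal_gen X f, f != 0 & lm f = lexp ord p].
Proof.
move=> Ip p0; set u0 := lexp ord p; pose W := mweight u0.
have [f If [Wf pf]] := in_w_ideal_lift W Ip; exists f.
have G0 : value_group v (W - mweight u0) by rewrite subrr; apply: value_group0.
have pu0 : p@_u0 != 0 := lterm_neq0 ord p0.
have vr := scaled_coef_valring G0 (Wf u0).
move: pu0; rewrite pf // residue_eq0 // subrr negb_or => /andP[nz vle].
have fu0 : f@_u0 != 0 by apply: contraNneq nz => ->; rewrite mulr0.
have t0 : t 0 != 0 by apply: contraNneq nz => ->; rewrite mul0r.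
have vfu0 : v f@_u0 = 0.
  apply/eqP; rewrite eq_le; apply/andP; split.
    by move: vle; rewrite valuationM // splitting0 add0r -leNgt.
  have := Wf u0; rewrite mcoeff_msupp fu0 => /(_ isT).
  by rewrite /Defs.term_weight -/(mweight _) lerDr.
have f0 : f != 0 by apply: contraNneq fu0 => ->; rewrite mcoeff0.
have wu0 : term_weight f@_u0 u0 = W by rewrite /Defs.term_weight vfu0 add0r.
split=> //; have : lkey f = tkey v w f@_u0 u0.
  apply: lkeyP; first by rewrite mcoeff_msupp.
  move=> u uf; rewrite /kle /= wu0; have := Wf u uf; rewrite le_eqVlt.
  case/orP=> [/eqP eW|->//]; rewrite -eW eqxx /=; apply/orP; right.
  apply: lexp_max; rewrite mcoeff_msupp.
  have fu : f@_u != 0 by rewrite -mcoeff_msupp.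
  (* Another term of weight [W] also lies in the controlled class, so [u] occurs in [p] and is at
     most [u0]. *)
  have vE : W - mweight u = v f@_u.
    by rewrite eW /Defs.term_weight -/(mweight _) addrK.
  have [nz1 v1] := splitting_unit t fu.
  rewrite pf; last by rewrite vE; apply: value_groupE.
  by rewrite -opprB vE; apply: residue_unit.
by move/(congr1 snd).
Qed.

End InitialIdeal.

(** * Termination and correctness of the algorithm *)

Section Dickson.

Lemma strict_mono_lt (f : nat -> nat) : (forall i, (f i < f i.+1)%N) ->
  forall i j, (i < j)%N -> (f i < f j)%N.
Proof.
move=> fS; apply: (@homo_ltn nat f (fun i j => (i < j)%N)) => // j i k.
exact: ltn_trans.
Qed.

(** Each index is chosen to minimise [g] on the tail that starts just after the previous index. *)
Lemma exists_monotone_subseq (g : nat -> nat) : exists f : nat -> nat,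
  (forall i, (f i < f i.+1)%N) /\ (forall i, (g (f i) <= g (f i.+1))%N).
Proof.
have min_from N : exists j, (N <= j)%N /\ forall k, (N <= k)%N -> (g j <= g k)%N.
  (* The bound [m] on the current value makes the descent to a minimiser finite. *)
  suff H m j : (N <= j)%N -> (g j < m)%N ->
      exists j, (N <= j)%N /\ forall k, (N <= k)%N -> (g j <= g k)%N.
    by apply: (H (g N).+1 N).
  elim: m j => // m IHm j Nj gj.
  case: (pselect (exists2 k, (N <= k)%N & (g k < g j)%N)) => [[k Nk gkj]|nex].
    by apply: (IHm _ Nk); apply: leq_trans gkj _.
  exists j; split=> // k Nk; rewrite leqNgt; apply/negP => gkj.
  by apply: nex; exists k.
have [J JP] := choice min_from.
exists (fun i => iter i (fun x => J x.+1) (J 0)); split=> i /=.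
  by have [] := JP (iter i (fun x => J x.+1) (J 0)).+1.
set x := iter _ _ _; have [ltx _] := JP x.+1.
(* The index [x] was a minimiser on a tail containing it, hence also on the tail starting at [x]. *)
have xle k : (x <= k)%N -> (g x <= g k)%N.
  rewrite /x; case: i {x ltx} => [|i] /=; first by case: (JP 0) => _ le0 _; apply: le0.
  set y := iter _ _ _; have [lty ley] := JP y.+1.
  by move=> le_k; apply: ley; apply: leq_trans lty le_k.
by apply: xle; apply: ltnW.
Qed.

(** Coordinates are made monotone one after another, each along a subsequence of the previous one;
    the first two terms of the last subsequence are comparable. *)
Lemma dickson n (s : nat -> 'X_{1..n}) : exists i j, (i < j)%N /\ (s i <= s j)%MM.
Proof.
have sub k : exists f : nat -> nat, (forall i, (f i < f i.+1)%N) /\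
    forall l : 'I_n, (l < k)%N -> forall i, (s (f i) l <= s (f i.+1) l)%N.
  elim: k => [|k [f [f_lt f_le]]]; first by exists id.
  have [nk|kn] := leqP n k.
    exists f; split=> // l _; apply: f_le; exact: leq_trans (ltn_ord l) nk.
  have [h [h_lt h_le]] := exists_monotone_subseq (fun i => s (f i) (Ordinal kn)).
  exists (fun i => f (h i)); split=> [i|l lk i]; first exact: strict_mono_lt.
  have [->|nlk] := eqVneq l (Ordinal kn); first exact: h_le.
  have {}lk : (l < k)%N.
    by rewrite ltn_neqAle -ltnS lk andbT; apply: contra nlk => /eqP e; apply/eqP/val_inj.
  have : {homo (fun i => s (f i) l) : i j / (i <= j)%N >-> (i <= j)%N}.
    by apply: homo_leq => [x|y x z|j]; [exact: leqnn | exact: leq_trans | exact: f_le].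
  by apply; apply: ltnW.
have [f [f_lt f_le]] := sub n; exists (f 0), (f 1); split=> //.
by apply/mnm_lepP => l; apply: f_le.
Qed.

End Dickson.

Section Termination.
Context (R : realType) (K : fieldType) (v : valuation R K) (t : splitting v).
Context (n : nat) (w : 'rV[R]_n) (ord : term_order n).

Local Notation S := {mpoly K[n]}.
Local Notation lm := (lm t w ord).
Local Notation bstep := (bstep t w ord).

Local Opaque Defs.in_w lexp Defs.lm Defs.lweight Defs.lc.

Definition grows (G' G : {fset S}) : Prop :=
  exists r : S, (forall g, g \in G -> ~~ (lm g <= lm r)%MM) /\ G' = r |` G.

(** A set that is not accessible has a successor that is not accessible. Iterating gives an infinite
    sequence of leading exponents none of which divides a later one, against [dickson]. *)
Lemma grows_wf : well_founded grows.
Proof.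
move=> G0; apply: contrapT => nacc.
pose bad := {G : {fset S} | ~ Acc grows G}.
have next (G : bad) : exists rG : S * bad,
    (forall g, g \in sval G -> ~~ (lm g <= lm rG.1)%MM) /\ sval rG.2 = rG.1 |` sval G.
  case: G => G nG /=; apply: contrapT => nex; apply: nG; constructor.
  move=> G' [r [rG eG]]; apply: contrapT => nG'; apply: nex.
  by exists (r, exist _ G' nG').
have [F FP] := choice next.
pose G i : bad := iter i (fun G => (F G).2) (exist _ G0 nacc).
pose r i := (F (G i)).1.
have G_sub i j : (i <= j)%N -> forall g, g \in sval (G i) -> g \in sval (G j).
  move=> /subnK <-; elim: (j - i)%N => // k IHk g gi.
  by rewrite addSn /= (FP _).2 in_fsetU IHk ?orbT.
have r_in i : r i \in sval (G i.+1) by rewrite /= (FP _).2 fset1U1.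
have [i [j [ij le_ij]]] := dickson (fun i => lm (r i)).
by have := (FP (G j)).1 _ (G_sub _ _ ij _ (r_in i)); rewrite le_ij.
Qed.

Lemma normal_form_lm (G : {fset S}) f r : normal_form t w ord G f r -> r != 0 ->
  forall g, g \in G -> ~~ (lm g <= lm r)%MM.
Proof.
move=> [_ [h [_ _ _ _ ndiv]]] r0 g gG.
have iG : (index g G < size G)%N by rewrite index_mem.
by have := ndiv _ (lm_supp t w ord r0) (Ordinal iG); rewrite /= nth_index.
Qed.

(** The measure is lexicographic: either [G] grows, or it stays and a pair is removed from [P]. *)
Lemma bstep_wf : well_founded (fun st' st => bstep st st').
Proof.
case=> G; elim: G / (grows_wf G) => G _ IHG P.
have [m] := ubnP #|` P|; elim: m P => [P|m IHm P leP]; first by rewrite ltn0.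
constructor => st'.
case=> p [r [pP nf st'E]]. rewrite {}st'E /bnext; case: eqVneq => r0.
  by apply: IHm; move: leP; rewrite (cardfsD1 p P) pP add1n ltnS.
apply: IHG; exists r; split; last by [].
exact: normal_form_lm nf r0.
Qed.

End Termination.

Section Correctness.
Context (R : realType) (K : fieldType) (v : valuation R K) (t : splitting v).
Context (n : nat) (w : 'rV[R]_n) (ord : term_order n).

Local Notation S := {mpoly K[n]}.
Local Notation lm := (lm t w ord).
Local Notation spoly := (spoly t w ord).
Local Notation bstep := (bstep t w ord).
Local Notation std_rep := (std_rep t w ord).

Local Opaque Defs.in_w lexp Defs.lm Defs.lweight Defs.lc mlcm.

Lemma spoly_homog g g' : g != 0 -> g' != 0 -> homogeneous g -> homogeneous g' ->
  homogeneous (spoly g g').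
Proof.
move=> g0 g'0 gh g'h; exists (mdeg (mlcm (lm g) (lm g'))).
apply: rpredB; apply: rpredZ.
  by rewrite -[X in mdeg X](submK (lem_mlcml (lm g) (lm g'))); apply: dhomogXM.
by rewrite -[X in mdeg X](submK (lem_mlcmr (lm g) (lm g'))); apply: dhomogXM.
Qed.

(** Indexing the cofactors by the elements of [G] rather than by positions allows them to be carried
    over when [G] changes. *)
Lemma normal_form_sum (G : {fset S}) f r : normal_form t w ord G f r ->
  exists h : S -> S, [/\ f = \sum_(g <- G) h g * g + r,
    forall g, g \in G -> pge t w ord (h g * g) f & pge t w ord r f].
Proof.
move=> [_ [h [_ fE hge rge _]]].
pose h' g := if insub (index g G) is Some i then h i else 0.
have h'E (i : 'I_(size G)) : h' G`_i = h i.
  by rewrite /h' index_uniq ?fset_uniq //; case: insubP => [j _ /val_inj ->|/negP[]].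
exists h'; split; last exact: rge.
  by rewrite {1}fE (big_nth 0) big_mkord; congr (_ + _); apply: eq_bigr => i _; rewrite h'E.
move=> g gG; have iG : (index g G < size G)%N by rewrite index_mem.
by have := hge (Ordinal iG); rewrite -h'E /= nth_index.
Qed.

Lemma std_rep_fset1U (G : {fset S}) f r : r \notin G -> std_rep G f -> std_rep (r |` G) f.
Proof.
move=> rG [h [fE hge]]; exists (fun g => if g \in G then h g else 0); split.
  rewrite big_fsetU1 //= (negPf rG) mul0r add0r fE.
  by rewrite big_seq [RHS]big_seq; apply: eq_bigr => g ->.
by move=> g _; case: ifP => [/hge //|_]; rewrite mul0r pge0.
Qed.

Context (fs : seq S) (fs_neq0 : forall f, f \in fs -> f != 0)
  (fs_homog : forall f, f \in fs -> homogeneous f).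

Definition buchberger_inv (st : bstate K n) : Prop :=
  [/\ forall f, f \in fs -> f \in st.1,
      forall g, g \in st.1 ->
        [/\ g != 0, homogeneous g & ideal_gen (fun f => f \in fs) g],
      forall p, p \in st.2 -> p.1 \in st.1 /\ p.2 \in st.1
    & forall g g', g \in st.1 -> g' \in st.1 ->
        [\/ (g, g') \in st.2, (g', g) \in st.2, std_rep st.1 (spoly g g')
          | std_rep st.1 (spoly g' g)]].

Lemma buchberger_inv_init : buchberger_inv (binit fs).
Proof.
have memG g : (g \in [fset g in fs]) = (g \in fs) by rewrite in_fset.
split=> /=.
- by move=> f; rewrite memG.
- move=> g; rewrite memG => gs; split; [exact: fs_neq0 | exact: fs_homog |].
  exact: ideal_gen_mem.
- by move=> [g g']; rewrite in_fsetM /= => /andP[].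
by move=> g g' gG g'G; apply: Or41; rewrite in_fsetM /= gG.
Qed.

Lemma buchberger_inv_step st st' : bstep st st' -> buchberger_inv st -> buchberger_inv st'.
Proof.
case: st => G P [[g g'] [r [/= pP nf ->]]] [/= fsG GP PG rep].
have [gG g'G] := PG _ pP; rewrite /= in gG g'G.
have [h [sE hge rge]] := normal_form_sum nf.
rewrite /bnext; case: eqVneq => [r0|r0].
  split=> //=.
    by move=> p /fsetD1P[_ /PG].
  have rep_s : std_rep G (spoly g g') by exists h; rewrite {1}sE r0 addr0.
  move=> g1 g2 g1G g2G; case: (rep g1 g2 g1G g2G) => H.
  - have [[-> ->]|ne] := eqVneq (g1, g2) (g, g'); first exact: Or43.
    by apply: Or41; apply/fsetD1P.
  - have [[-> ->]|ne] := eqVneq (g2, g1) (g, g'); first exact: Or44.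
    by apply: Or42; apply/fsetD1P.
  - exact: Or43.
  exact: Or44.
have ndiv := normal_form_lm nf r0.
have rG : r \notin G by apply/negP => /ndiv; rewrite lepm_refl.
(* Once [r] is adjoined, the division is a representation with cofactor [1] at [r]. *)
have rep_s : std_rep (r |` G) (spoly g g').
  exists (fun g1 => if g1 \in G then h g1 else 1); split.
    rewrite big_fsetU1 //= (negPf rG) mul1r {1}sE addrC; congr (_ + _).
    by rewrite big_seq [RHS]big_seq; apply: eq_bigr => g1 ->.
  move=> g1 /fset1UP[->|g1G]; first by rewrite (negPf rG) mul1r.
  by rewrite g1G; apply: hge.
split=> /=.
- by move=> f /fsG fG; rewrite in_fset1U fG orbT.
- move=> g1 /fset1UP[->|/GP //]; split=> //; first by case: nf.
  have -> : r = spoly g g' + \sum_(g <- G) (- h g) * g.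
    rewrite {1}sE addrAC -big_split /= big1 ?add0r // => i _.
    by rewrite -mulrDl subrr mul0r.
  have [_ _ Ig] := GP _ gG; have [_ _ Ig'] := GP _ g'G.
  apply: ideal_genD; last first.
    by apply: ideal_gen_sum => g2 g2G; apply: ideal_genM; case: (GP _ g2G).
  rewrite /Defs.spoly -scaleNr -!mul_mpolyC.
  by apply: ideal_genD; do 2!apply: ideal_genM.
- move=> p /fsetUP[/fsetD1P[_ /PG[p1 p2]]|/imfsetP[g1 /= g1G ->]] /=.
    by rewrite !in_fset1U p1 p2 !orbT.
  by rewrite fset1U1.
have new g1 : g1 \in r |` G ->
    (r, g1) \in (P `\ (g, g')) `|` [fset (r, g0) | g0 in r |` G].
  by move=> g1G; apply/fsetUP; right; apply/imfsetP; exists g1.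
(* New pairs are queued with [r] in front, so a pair ending in [r] uses the reversed alternative. *)
move=> g1 g2 /fset1UP[->|g1G] /fset1UP[->|g2G].
- by apply: Or41; apply: new; rewrite fset1U1.
- by apply: Or41; apply: new; rewrite in_fset1U g2G orbT.
- by apply: Or42; apply: new; rewrite in_fset1U g1G orbT.
case: (rep g1 g2 g1G g2G) => H.
- have [[-> ->]|ne] := eqVneq (g1, g2) (g, g'); first exact: Or43.
  by apply: Or41; apply/fsetUP; left; apply/fsetD1P.
- have [[-> ->]|ne] := eqVneq (g2, g1) (g, g'); first exact: Or44.
  by apply: Or42; apply/fsetUP; left; apply/fsetD1P.
- by apply: Or43; apply: std_rep_fset1U.
by apply: Or44; apply: std_rep_fset1U.
Qed.

Lemma buchberger_inv_reachable st : breachable t w ord fs st -> buchberger_inv st.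
Proof.
move=> reach; suff: buchberger_inv (binit fs) -> buchberger_inv st.
  by apply; apply: buchberger_inv_init.
elim: reach => [x y|//|x y z _ IHxy _ IHyz /IHxy //]; exact: buchberger_inv_step.
Qed.

Lemma buchberger_inv_correct (G : {fset S}) : buchberger_inv (G, fset0) ->
  forall f, ideal_gen (fun g => g \in fs) f -> f != 0 ->
  exists2 g, g \in G & (lm g <= lm f)%MM.
Proof.
move=> [/= fsG GP _ rep] f If f0.
apply: (@lm_multiple_of_std_rep _ _ _ t _ w ord G) => //.
- by move=> g /GP[].
- by move=> g /GP[].
- move=> g g' gG g'G; case: (rep g g' gG g'G) => H; first 2 last.
  + by left.
  + by right.
  + by rewrite in_fset0 in H.
  by rewrite in_fset0 in H.
apply: ideal_gen_sub If => g /fsG gG.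
exact: (@ideal_gen_mem _ (fun g => g \in G)).
Qed.

End Correctness.


Lemma lterm_dvd n (k : fieldType) (ord : term_order n) (X : {mpoly k[n]} -> Prop)
    (p q : {mpoly k[n]}) :
  q != 0 -> X (lterm ord q) -> (lexp ord q <= lexp ord p)%MM ->
  ideal_gen X (lterm ord p).
Proof.
move=> q0 Xq le_qp; have cq := lterm_neq0 ord q0.
have -> : lterm ord p = (p@_(lexp ord p) / q@_(lexp ord q)) *:
    'X_[lexp ord p - lexp ord q] * lterm ord q.
  rewrite /lterm -scalerAl -scalerAr scalerA divfK //.
  by rewrite -mpolyXD submK.
exact/ideal_genM/ideal_gen_mem.
Qed.

Theorem mainTheorem3
  (R : realType) (K : fieldType) (v : valuation R K) (t : splitting v)
  (n : nat) (w : 'rV[R]_n) (ord : term_order n)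
  (fs : seq {mpoly K[n]})
  (fs_neq0 : forall f, f \in fs -> f != 0)
  (fs_homog : forall f, f \in fs -> homogeneous f) :
  let I : {mpoly K[n]} -> Prop := ideal_gen (fun f => f \in fs) in
  [/\ (* every run is finite *)
      Acc (fun st' st => bstep t w ord st st') (binit fs),
      (* every choice of a pair can be carried out, so that a run only stops
         when there are no pairs left *)
      forall (G : {fset {mpoly K[n]}}) (P : {fset {mpoly K[n]} * {mpoly K[n]}}),
        breachable t w ord fs (G, P) ->
        forall p, p \in P ->
        exists r, normal_form t w ord G (spoly t w ord p.1 p.2) r
    & (* correctness of the output *)
      forall G : {fset {mpoly K[n]}},
        breachable t w ord fs (G, fset0) ->
        (forall g, g \in G -> homogeneous g /\ I g) /\
        (forall q : {mpoly (residue_field v)[n]},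
           ideal_gen (fun q' => exists2 g, g \in G & q' = lterm ord (in_w t w g)) q
           <-> lterm_ideal ord (in_w_ideal t w I) q)].
Proof.
move=> I; split; first exact: bstep_wf.
  move=> G P /(buchberger_inv_reachable fs_neq0 fs_homog)[/= _ GP PG _] p /PG[p1 p2].
  have [nz1 h1 _] := GP _ p1; have [nz2 h2 _] := GP _ p2.
  apply: normal_form_exists; last exact: spoly_homog.
    by move=> g /GP[].
  by move=> g /GP[].
move=> G /(buchberger_inv_reachable fs_neq0 fs_homog) inv.
have [/= _ GP _ _] := inv; split; first by move=> g /GP[].
move=> q; split; apply: ideal_gen_sub => {}q.
  case=> g gG ->; have [g0 _ Ig] := GP _ gG; apply: ideal_gen_mem.
  exists (in_w t w g); rewrite in_w_eq0; split=> //.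
  by apply: ideal_gen_mem; exists g.
(* A leading exponent of the initial ideal is that of some [f] in [I], and the criterion provides a
   [g] whose leading exponent divides it. *)
case=> p [Ip p0 ->]; have [f [If f0 lmf]] := lexp_in_w_ideal ord Ip p0.
have [g gG le_gf] := buchberger_inv_correct inv If f0.
have [g0 _ _] := GP _ gG.
apply: (@lterm_dvd _ _ _ _ _ (in_w t w g)); first by rewrite in_w_eq0.
  by exists g.
by rewrite -lmf.
Qed.
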